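(* Let $U$ be a pseudoreductive Hopf algebra over $\boldsymbol k$. Then $T(U)_{\rm inn}$ is a pseudoreductive triple.
   Context: $\boldsymbol k$ is a field of characteristic zero. A (unital) bialgebra is a vector space $U$ with a bilinear, not necessarily associative product with unit $1$, and a coassociative cocommutative comultiplication $\Delta(u)=u_{(1)}\otimes u_{(2)}$ (Sweedler notation, summation understood) with counit $\epsilon$, such that $\Delta,\epsilon$ are homomorphisms of unital algebras. $\mathrm{Prim}(U)=\{a\mid\Delta(a)=a\otimes1+1\otimes a\}$; $R_a\colon x\mapsto xa$. A non-associative Hopf algebra is a unital bialgebra with bilinear maps $\backslash,/$ satisfying $u_{(1)}\backslash(u_{(2)}v)=\epsilon(u)v=u_{(1)}(u_{(2)}\backslash v)$ and $(uv_{(1)})/v_{(2)}=\epsilon(v)u=(u/v_{(1)})v_{(2)}$. A non-associative Hopf algebra $U$ is pseudoreductive if: (right pseudospeciality) there is a coalgebra morphism $\bullet\colon U\otimes U\to U$ with $1\bullet u=\epsilon(u)1=u\bullet1$ and $P(u,v)(xy)=r(u_{(1)},v_{(1)})(x)\,P(u_{(2)},v_{(2)})(y)$ for all $u,v,x,y$, where $r(u,v)(x):=((xu_{(1)})v_{(1)})/(u_{(2)}v_{(2)})$ and $P(u,v)(x):=r(u_{(1)},v_{(1)})(x)\,(u_{(2)}\bullet v_{(2)})$; and (right monoalternativity) $(((xy_{(1)})y_{(2)})\cdots)y_{(n)}=x((y_{(1)}y_{(2)})\cdots y_{(n)})$ for all $x,y$ and $n\ge0$ (left-normed products). A triple $(\mathfrak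 g,\mathfrak s,\mathfrak c)$ consists of a Lie algebra $\mathfrak g$, a subalgebra $\mathfrak s$ and a subspace $\mathfrak c$ with $\mathfrak g=\mathfrak s\oplus\mathfrak c$. It is pseudoreductive if there exists a map $\zeta\colon\mathfrak s\to\mathfrak c$ such that (PRT1) $d+\zeta(d)\in N_{\mathfrak g}(\mathfrak c):=\{x\in\mathfrak g\mid[x,\mathfrak c]\subseteq\mathfrak c\}$ for all $d\in\mathfrak s$, and (PRT2) $\mathrm{ad}_c^{2n}(\zeta(\mathfrak s))\subseteq\mathfrak c$ for all $n\ge0$ and $c\in\mathfrak c$. For a triple $\tau$, $\tau_{\rm inn}=(\mathfrak g_{\rm inn},\mathfrak s_{\rm inn},\mathfrak c)$ with $\mathfrak g_{\rm inn}$ the Lie subalgebra generated by $\mathfrak c$ and $\mathfrak s_{\rm inn}=\mathfrak g_{\rm inn}\cap\mathfrak s$. For a unital bialgebra $U$, $T(U)=(\mathfrak g(U),\mathfrak s(U),\mathfrak c(U))$ where $\mathfrak g(U)=\{f\in\mathrm{End}_{\boldsymbol k}(U)\mid\Delta(f(u))=f(u_{(1)})\otimes u_{(2)}+u_{(1)}\otimes f(u_{(2)})\ \forall u\}$ (commutator bracket), $\mathfrak s(U)=\{f\in\mathfrak g(U)\mid f(1)=0\}$, $\mathfrak c(U)=\{R_a\mid a\in\mathrm{Prim}(U)\}$. *)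

(* Defs.v *)
From HB Require Import structures.
From mathcomp Require Import all_boot all_order all_algebra.
From mathcomp Require Import boolp classical_sets.

Set Implicit Arguments.
Unset Strict Implicit.
Unset Printing Implicit Defensive.

Import GRing.Theory.

Local Open Scope classical_set_scope.
Local Open Scope ring_scope.
Local Open Scope quotient_scope.

Reserved Notation "u \ox v" (at level 40, left associativity).
Reserved Notation "\sw_ ( a , b <- t ) E"
  (at level 41, E at level 41, a, b at level 0, t at level 60,
   format "'[' \sw_ ( a ,  b  <-  t ) '/  '  E ']'").
Reserved Notation "x *h y" (at level 40, left associativity).
Reserved Notation "x \h y" (at level 40, left associativity).
Reserved Notation "x /h y" (at level 40, left associativity).
Reserved Notation "1h" (at level 0).

(* The tensor product over k: finite formal sums of pairs (scalars are         *)
(* absorbed in the left factor) modulo the smallest congruence making the      *)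
(* class of (u, v) bilinear. tensor_ind, sweedler_tens and sweedler_linear     *)
(* below establish its universal property.                                     *)
Section Tensor.
Variables (k : fieldType) (U V : lmodType k).

Inductive tens_rel : seq (U * V) -> seq (U * V) -> Prop :=
| TensRefl s : tens_rel s s
| TensSym s t : tens_rel s t -> tens_rel t s
| TensTrans t s r : tens_rel s t -> tens_rel t r -> tens_rel s r
| TensCat s s' t t' : tens_rel s s' -> tens_rel t t' ->
    tens_rel (s ++ t) (s' ++ t')
| TensC s t : tens_rel (s ++ t) (t ++ s)
| TensDl u u' v : tens_rel [:: (u + u', v)] [:: (u, v); (u', v)]
| TensDr u v v' : tens_rel [:: (u, v + v')] [:: (u, v); (u, v')]
| TensZ a u v : tens_rel [:: (a *: u, v)] [:: (u, a *: v)]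
| Tens0 v : tens_rel [:: (0, v)] [::].

Definition tens_relb s t := `[< tens_rel s t >].

Lemma tens_relb_refl : reflexive tens_relb.
Proof. by move=> s; apply/asboolP; exact: TensRefl. Qed.

Lemma tens_relb_sym : symmetric tens_relb.
Proof. by move=> s t; apply/asboolP/asboolP; exact: TensSym. Qed.

Lemma tens_relb_trans : transitive tens_relb.
Proof.
by move=> t s r /asboolP st /asboolP tr; apply/asboolP; exact: TensTrans st tr.
Qed.

Canonical tens_equiv :=
  EquivRel tens_relb tens_relb_refl tens_relb_sym tens_relb_trans.

Definition tensor := {eq_quot tens_equiv}.
HB.instance Definition _ := Choice.on tensor.
HB.instance Definition _ := Quotient.on tensor.

Lemma tens_eqP s t : \pi_tensor s = \pi_tensor t <-> tens_rel s t.
Proof. by split=> [/eqmodP/asboolP|/asboolP ?] //; apply/eqmodP. Qed.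

Lemma tens_repr s : tens_rel (repr (\pi_tensor s)) s.
Proof. by apply/tens_eqP; rewrite reprK. Qed.

Lemma tensorW (P : tensor -> Prop) :
  (forall s, P (\pi_tensor s)) -> forall x, P x.
Proof. by move=> Ppi x; rewrite -[x]reprK. Qed.

Definition scale_seq (a : k) (s : seq (U * V)) := [seq (a *: p.1, p.2) | p <- s].

Lemma scale_seq_rel a s t :
  tens_rel s t -> tens_rel (scale_seq a s) (scale_seq a t).
Proof.
elim=> {s t} [s|s t _|t s r _ st _|s s' t t' _ ss' _|s t|u u' v|u v v'|b u v|v].
- exact: TensRefl.
- exact: TensSym.
- exact: TensTrans st.
- by rewrite /scale_seq !map_cat; exact: TensCat ss'.
- by rewrite /scale_seq !map_cat; exact: TensC.
- by rewrite /= scalerDr; exact: TensDl.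
- exact: TensDr.
- by rewrite /= scalerA mulrC -scalerA; exact: TensZ.
- by rewrite /= scaler0; exact: Tens0.
Qed.

Definition tens_zero : tensor := \pi_tensor [::].
Definition tens_add (x y : tensor) : tensor := \pi_tensor (repr x ++ repr y).
Definition tens_scale (a : k) (x : tensor) : tensor :=
  \pi_tensor (scale_seq a (repr x)).
Definition tens_opp (x : tensor) := tens_scale (-1) x.

Lemma tens_addE s t :
  tens_add (\pi_tensor s) (\pi_tensor t) = \pi_tensor (s ++ t).
Proof. by apply/tens_eqP/TensCat; exact: tens_repr. Qed.

Lemma tens_consE p s :
  \pi_tensor (p :: s) = tens_add (\pi_tensor [:: p]) (\pi_tensor s).
Proof. by rewrite tens_addE. Qed.

Lemma tens_scaleE a s :
  tens_scale a (\pi_tensor s) = \pi_tensor (scale_seq a s).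
Proof. by apply/tens_eqP/scale_seq_rel; exact: tens_repr. Qed.

Lemma tens_addA : associative tens_add.
Proof.
move=> x y z; elim/tensorW: x => x; elim/tensorW: y => y; elim/tensorW: z => z.
by rewrite !tens_addE catA.
Qed.

Lemma tens_addC : commutative tens_add.
Proof. by move=> x y; apply/tens_eqP; exact: TensC. Qed.

Lemma tens_add0 : left_id tens_zero tens_add.
Proof. by elim/tensorW=> s; rewrite tens_addE. Qed.

Lemma tens_scaleA a b x : tens_scale a (tens_scale b x) = tens_scale (a * b) x.
Proof.
elim/tensorW: x => s; rewrite !tens_scaleE /scale_seq -map_comp.
by congr \pi_tensor; apply: eq_map => p /=; rewrite scalerA.
Qed.

Lemma tens_scale1 : left_id 1 tens_scale.
Proof.
elim/tensorW=> s; rewrite tens_scaleE; congr \pi_tensor.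
by rewrite -[RHS]map_id; apply: eq_map => -[u v] /=; rewrite scale1r.
Qed.

Lemma tens_scaleDr : right_distributive tens_scale tens_add.
Proof.
move=> a x y; elim/tensorW: x => s; elim/tensorW: y => t.
by rewrite !(tens_addE, tens_scaleE) /scale_seq map_cat.
Qed.

Lemma tens_scaleDl x :
  {morph tens_scale^~ x : a b / a + b >-> tens_add a b}.
Proof.
move=> a b /=; elim/tensorW: x => s; rewrite !tens_scaleE.
elim: s => [|[u v] s IHs]; first by rewrite tens_addE.
rewrite /scale_seq !map_cons /= -/(scale_seq _ s).
rewrite -/(scale_seq a s) -/(scale_seq b s).
rewrite (tens_consE (_, _) (scale_seq (a + b) s)).
rewrite (tens_consE (_, _) (scale_seq a s)) (tens_consE (_, _) (scale_seq b s)).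
rewrite IHs scalerDl.
have -> : \pi_tensor [:: (a *: u + b *: u, v)] =
    tens_add (\pi_tensor [:: (a *: u, v)]) (\pi_tensor [:: (b *: u, v)]).
  by rewrite tens_addE; apply/tens_eqP; exact: TensDl.
rewrite -!tens_addA; congr tens_add.
by rewrite !tens_addA; congr tens_add; exact: tens_addC.
Qed.

Lemma tens_addN : left_inverse tens_zero tens_opp tens_add.
Proof.
move=> x; rewrite /tens_opp -[X in tens_add _ X]tens_scale1 -tens_scaleDl addNr.
elim/tensorW: x => s; rewrite tens_scaleE; apply/tens_eqP.
elim: s => [|[u v] s IHs]; first exact: TensRefl.
rewrite /= scale0r -[X in tens_rel X _]cat1s -[X in tens_rel _ X]cats0.
by apply: TensCat; [exact: Tens0|exact: IHs].
Qed.

HB.instance Definition _ :=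
  GRing.isZmodule.Build tensor tens_addA tens_addC tens_add0 tens_addN.
HB.instance Definition _ :=
  GRing.Zmodule_isLmodule.Build k tensor tens_scaleA tens_scale1
    tens_scaleDr tens_scaleDl.

Definition tens (u : U) (v : V) : tensor := \pi_tensor [:: (u, v)].

Lemma tens_is_bilinear : bilinear_for *:%R *:%R tens.
Proof.
split=> [v|u] a x y /=.
  rewrite -[RHS]/(tens_add (tens_scale _ _) _) tens_scaleE tens_addE.
  by apply/tens_eqP; exact: TensDl.
rewrite -[RHS]/(tens_add (tens_scale _ _) _) tens_scaleE tens_addE.
apply/tens_eqP; apply: (TensTrans (TensDr _ _ _)).
rewrite -cat1s -[X in tens_rel _ X]cat1s; apply: TensCat; last exact: TensRefl.
by apply: TensSym; exact: TensZ.
Qed.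

HB.instance Definition _ :=
  bilinear_isBilinear.Build k U V tensor *:%R *:%R tens tens_is_bilinear.

Lemma tensor_ind (P : tensor -> Prop) :
  P 0 -> (forall u v x, P x -> P (tens u v + x)) -> forall x, P x.
Proof.
move=> P0 PD; elim/tensorW; elim=> [|[u v] s IHs]; first exact: P0.
by have := PD u v _ IHs; rewrite -[_ + _]/(tens_add _ _) tens_addE.
Qed.

(* Sweedler notation: for t = \sum_i u_i \ox v_i, this is \sum_i f u_i v_i. It *)
(* is computed on a chosen decomposition of t, and is only meaningful when f   *)
(* is bilinear, in which case the choice is irrelevant.                        *)
Definition sweedler (W : lmodType k) (f : U -> V -> W) (t : tensor) : W :=
  \sum_(p <- repr t) f p.1 p.2.

Section Sweedler.
Variables (W : lmodType k) (f : U -> V -> W).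
Hypothesis fP : bilinear_for *:%R *:%R f.

Let fb : {bilinear U -> V -> W} :=
  HB.pack f (bilinear_isBilinear.Build k U V W *:%R *:%R f fP).

Lemma sweedler_pi s : sweedler f (\pi_tensor s) = \sum_(p <- s) f p.1 p.2.
Proof.
suff E r t : tens_rel r t -> \sum_(p <- r) f p.1 p.2 = \sum_(p <- t) f p.1 p.2.
  by apply: E; exact: tens_repr.
elim=> {s r t} [s|s t _ ->|t s r _ -> _ ->|s s' t t' _ es _ et|s t
    |u u' v|u v v'|a u v|v]; rewrite ?big_cat ?big_cons ?big_nil ?addr0 //=.
- by rewrite es et.
- exact: addrC.
- exact: (linearDl fb).
- exact: (linearDr fb).
- exact: etrans (linearZl_LR fb v a u) (esym (linearZr_LR fb u a v)).
- exact: (linear0l fb).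
Qed.

Lemma sweedler_tens u v : sweedler f (tens u v) = f u v.
Proof. by rewrite sweedler_pi big_seq1. Qed.

Lemma sweedler_linear : linear (sweedler f).
Proof.
move=> a x y; elim/tensorW: x => s; elim/tensorW: y => t.
rewrite -[a *: _ + _]/(tens_add (tens_scale _ _) _) tens_scaleE tens_addE.
rewrite !sweedler_pi big_cat big_map scaler_sumr; congr (_ + _).
by apply: eq_bigr => p _; exact: (linearZl_LR fb).
Qed.

End Sweedler.
End Tensor.

Notation "u \ox v" := (tens u v) : ring_scope.
Notation "\sw_ ( a , b <- t ) E" := (sweedler (fun a b => E) t) : ring_scope.

HB.mixin Record Lmodule_isBialgebra (k : fieldType) U of GRing.Lmodule k U := {
  hmul : {bilinear U -> U -> U};
  hone : U;
  comul : {linear U -> tensor U U};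
  counit : {scalar U};
  hmul1l : forall x, hmul hone x = x;
  hmul1r : forall x, hmul x hone = x;
  comulA : forall u,
    \sw_(a, b <- comul u) \sw_(a1, a2 <- comul a) (a1 \ox (a2 \ox b)) =
    \sw_(a, b <- comul u) \sw_(b1, b2 <- comul b) (a \ox (b1 \ox b2));
  comulC : forall u, \sw_(a, b <- comul u) (b \ox a) = comul u;
  counitl : forall u, \sw_(a, b <- comul u) (counit a *: b) = u;
  counitr : forall u, \sw_(a, b <- comul u) (counit b *: a) = u;
  comul1 : comul hone = hone \ox hone;
  comulM : forall u v, comul (hmul u v) =
    \sw_(u1, u2 <- comul u) \sw_(v1, v2 <- comul v)
      (hmul u1 v1 \ox hmul u2 v2);
  counit1 : counit hone = 1;
  counitM : forall u v, counit (hmul u v) = counit u * counit v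
}.

#[short(type="bialgType")]
HB.structure Definition Bialgebra (k : fieldType) :=
  {U of Lmodule_isBialgebra k U & GRing.Lmodule k U}.

Notation "x *h y" := (hmul x y) : ring_scope.
Notation "1h" := hone : ring_scope.

HB.mixin Record Bialgebra_isHopf (k : fieldType) U of Bialgebra k U := {
  ldiv : {bilinear U -> U -> U};
  rdiv : {bilinear U -> U -> U};
  ldivK : forall u v : U,
    \sw_(u1, u2 <- comul u) ldiv u1 (u2 *h v) = counit u *: v;
  mulldivK : forall u v : U,
    \sw_(u1, u2 <- comul u) (u1 *h ldiv u2 v) = counit u *: v;
  rdivK : forall u v : U,
    \sw_(v1, v2 <- comul v) rdiv (u *h v1) v2 = counit v *: u;
  mulrdivK : forall u v : U,
    \sw_(v1, v2 <- comul v) (rdiv u v1 *h v2) = counit v *: u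
}.

#[short(type="hopfType")]
HB.structure Definition Hopf (k : fieldType) :=
  {U of Bialgebra_isHopf k U & Bialgebra k U}.

Notation "x \h y" := (ldiv x y) : ring_scope.
Notation "x /h y" := (rdiv x y) : ring_scope.

Section PseudoreductiveHopf.
Variables (k : fieldType) (U : hopfType k).

(* A linear map U (x) U -> U compatible with the coalgebra structure of        *)
(* U (x) U, whose comultiplication maps u (x) v to                             *)
(* (u1 (x) v1) (x) (u2 (x) v2).                                                *)
Definition coalgebra_morphism2 (m : {linear tensor U U -> U}) :=
  (forall u v : U, comul (m (u \ox v)) =
     \sw_(u1, u2 <- comul u) \sw_(v1, v2 <- comul v)
       (m (u1 \ox v1) \ox m (u2 \ox v2))) /\
  (forall u v : U, counit (m (u \ox v)) = counit u * counit v).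

Definition rmap (u v x : U) : U :=
  \sw_(u1, u2 <- comul u) \sw_(v1, v2 <- comul v)
    (((x *h u1) *h v1) /h (u2 *h v2)).

Definition Pmap (m : {linear tensor U U -> U}) (u v x : U) : U :=
  \sw_(u1, u2 <- comul u) \sw_(v1, v2 <- comul v)
    (rmap u1 v1 x *h m (u2 \ox v2)).

Definition right_pseudospecial :=
  exists m : {linear tensor U U -> U},
  [/\ coalgebra_morphism2 m,
      forall u : U, m (1h \ox u) = counit u *: 1h,
      forall u : U, m (u \ox 1h) = counit u *: 1h
    & forall u v x y : U, Pmap m u v (x *h y) =
        \sw_(u1, u2 <- comul u) \sw_(v1, v2 <- comul v)
          (rmap u1 v1 x *h Pmap m u2 v2 y)].

(* n-fold Sweedler notation: the sum of F [:: y_(1); ...; y_(n)], for F        *)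
(* multilinear in the n entries of its argument.                               *)
Fixpoint sweedlern (W : lmodType k) (n : nat) (F : seq U -> W) (y : U) : W :=
  if n is n'.+1 then
    \sw_(a, b <- comul y) sweedlern n' (fun ys => F (rcons ys b)) a
  else counit y *: F [::].

(* Left-normed product ((y_1 y_2) ...) y_n; it is 1 when n = 0.                *)
Definition lnprod (ys : seq U) : U :=
  if ys is y :: ys' then foldl hmul y ys' else 1h.

Definition right_monoalternative :=
  forall (x y : U) (n : nat),
    sweedlern n (fun ys => foldl hmul x ys) y =
    sweedlern n (fun ys => x *h lnprod ys) y.

Definition pseudoreductive_hopf := right_pseudospecial /\ right_monoalternative.

End PseudoreductiveHopf.

HB.mixin Record Lmodule_isLieAlgebra (k : fieldType) L of GRing.Lmodule k L := {
  lieb : L -> L -> L;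
  lieb_bilinear : bilinear_for *:%R *:%R lieb;
  liebxx : forall x, lieb x x = 0;
  lieb_jacobi : forall x y z,
    lieb x (lieb y z) + lieb y (lieb z x) + lieb z (lieb x y) = 0
}.

#[short(type="lieAlgType")]
HB.structure Definition LieAlgebra (k : fieldType) :=
  {L of Lmodule_isLieAlgebra k L & GRing.Lmodule k L}.

HB.instance Definition _ (k : fieldType) (L : lieAlgType k) :=
  bilinear_isBilinear.Build k L L L *:%R *:%R (@lieb k L) lieb_bilinear.

(* Triples (g, s, c). The Lie algebra g is given as a Lie subalgebra of an     *)
(* ambient Lie algebra L, as groups are in mathcomp: g = setT recovers an      *)
(* abstract g.                                                                 *)
Section Triples.
Variables (k : fieldType) (L : lieAlgType k).

Definition subspace (A : set L) :=
  A 0 /\ (forall (a : k) x y, A x -> A y -> A (a *: x + y)).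

Definition lie_subalgebra (A : set L) :=
  subspace A /\ (forall x y, A x -> A y -> A (lieb x y)).

Record triple := Triple { tg : set L; ts : set L; tc : set L }.

Definition is_triple (tau : triple) :=
  [/\ lie_subalgebra (tg tau), lie_subalgebra (ts tau), subspace (tc tau),
      tg tau = [set d + c | d in ts tau & c in tc tau]
    & ts tau `&` tc tau = [set 0]].

Definition normalizer (g c : set L) : set L :=
  [set x | g x /\ forall y, c y -> c (lieb x y)].

(* zeta : s -> c is represented by a function on L, relevant only on s.        *)
Definition pseudoreductive_triple (tau : triple) :=
  is_triple tau /\
  exists zeta : L -> L,
  [/\ forall d, ts tau d -> tc tau (zeta d),
      forall d, ts tau d -> normalizer (tg tau) (tc tau) (d + zeta d)
    & forall (n : nat) c d, tc tau c -> ts tau d ->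
        tc tau (iter (2 * n) (lieb c) (zeta d))].

Definition lie_generated (A : set L) : set L :=
  [set x | forall B, lie_subalgebra B -> A `<=` B -> B x].

Definition inner (tau : triple) : triple :=
  Triple (lie_generated (tc tau)) (lie_generated (tc tau) `&` ts tau) (tc tau).

End Triples.

Section Endomorphisms.
Variables (k : fieldType) (U : lmodType k).

Definition endo := {linear U -> U}.
Implicit Types f g h : endo.

Lemma endoP f g : f =1 g -> f = g.
Proof.
case: f g => [f cf] [g cg] /= /funext fg; subst g; congr GRing.Linear.Pack.
case: cf cg => [[a] [b]] [[c] [d]].
by rewrite (Prop_irrelevance a c) (Prop_irrelevance b d).
Qed.

HB.instance Definition _ := gen_eqMixin endo.
HB.instance Definition _ := gen_choiceMixin endo.

Definition endo0 : endo := \0.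
Definition endo_opp f : endo := \- f.
Definition endo_add f g : endo := f \+ g.
Definition endo_scale (a : k) f : endo := a \*: f.
Definition endo_comp f g : endo := f \o g.

Fact endo_addA : associative endo_add.
Proof. by move=> f g h; apply/endoP => x; exact: addrA. Qed.
Fact endo_addC : commutative endo_add.
Proof. by move=> f g; apply/endoP => x; exact: addrC. Qed.
Fact endo_add0 : left_id endo0 endo_add.
Proof. by move=> f; apply/endoP => x; exact: add0r. Qed.
Fact endo_addN : left_inverse endo0 endo_opp endo_add.
Proof. by move=> f; apply/endoP => x; exact: addNr. Qed.
HB.instance Definition _ :=
  GRing.isZmodule.Build endo endo_addA endo_addC endo_add0 endo_addN.

Fact endo_scaleA a b f : endo_scale a (endo_scale b f) = endo_scale (a * b) f.
Proof. by apply/endoP => x; exact: scalerA. Qed.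
Fact endo_scale1 : left_id 1 endo_scale.
Proof. by move=> f; apply/endoP => x; exact: scale1r. Qed.
Fact endo_scaleDr : right_distributive endo_scale +%R.
Proof. by move=> a f g; apply/endoP => x; exact: scalerDr. Qed.
Fact endo_scaleDl f : {morph endo_scale^~ f : a b / a + b}.
Proof. by move=> a b; apply/endoP => x; exact: scalerDl. Qed.
HB.instance Definition _ :=
  GRing.Zmodule_isLmodule.Build k endo endo_scaleA endo_scale1
    endo_scaleDr endo_scaleDl.

Lemma endoDE f g x : (f + g) x = f x + g x. Proof. by []. Qed.
Lemma endoNE f x : (- f) x = - f x. Proof. by []. Qed.
Lemma endoZE (a : k) f x : (a *: f) x = a *: f x. Proof. by []. Qed.

Definition endo_bracket f g : endo := endo_comp f g - endo_comp g f.

Lemma endo_bracketE f g x : endo_bracket f g x = f (g x) - g (f x).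
Proof. by []. Qed.

Fact endo_bracket_bilinear : bilinear_for *:%R *:%R endo_bracket.
Proof.
split=> [h|h] a f g; apply/endoP => x;
  rewrite !(endoDE, endoZE, endo_bracketE) linearP scalerBr /= opprD.
  by rewrite addrACA.
by rewrite addrACA.
Qed.

Fact endo_bracketxx f : endo_bracket f f = 0.
Proof. exact: subrr. Qed.

Fact endo_jacobi f g h :
  endo_bracket f (endo_bracket g h) + endo_bracket g (endo_bracket h f) +
  endo_bracket h (endo_bracket f g) = 0.
Proof.
apply/endoP => x; rewrite !(endoDE, endo_bracketE) !linearB /=.
have E (a b c d : U) : a - b + (- c - - d) = (a + d) - (b + c).
  by rewrite opprK [- c + d]addrC addrACA -opprD.
rewrite !E [g (h (f x)) + f _]addrC subrKA.
by rewrite [h (f (g x)) + g _]addrC subrKA [h _ + f _]addrC subrr.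
Qed.

HB.instance Definition _ :=
  Lmodule_isLieAlgebra.Build k endo endo_bracket_bilinear
    endo_bracketxx endo_jacobi.

End Endomorphisms.

Section TripleOfBialgebra.
Variables (k : fieldType) (U : bialgType k).

Definition Prim : set U := [set a | comul a = a \ox 1h + 1h \ox a].

Definition rmul (a : U) : endo U := applyr hmul a.

Definition coder : set (endo U) :=
  [set f | forall u : U, comul (f u) =
     \sw_(u1, u2 <- comul u) (f u1 \ox u2 + u1 \ox f u2)].

Definition coder1 : set (endo U) := [set f | coder f /\ f 1h = 0].

Definition rprim : set (endo U) := [set rmul a | a in Prim].

Definition triple_of : triple (endo U) := Triple coder coder1 rprim.

End TripleOfBialgebra.

(* Main.v *)
From HB Require Import structures.
Require Import Defs.
From mathcomp Require Import all_boot all_order all_algebra.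
From mathcomp Require Import boolp classical_sets.
From mathcomp Require Import ring zify.

(** Write R_a for the right multiplication by a, and c for the space of the R_a
    with a primitive. The inner triple is generated by c, so the whole
    statement can be read off from what the two hypotheses say about primitive
    elements.

    Right monoalternativity says that R_a^n is the right multiplication by the
    n-th power of a (rmul_rpow). Replacing a by a + t b and extracting the
    coefficient of t, which is possible in characteristic zero, one finds that
    sum_i R_a^(n-1-i) R_b R_a^i is a right multiplication too
    (sandwich_rmuls).

    Right pseudospeciality, evaluated at primitive u = a and v = b, says that
    d = R_b R_a - R_(ab) satisfies T(xy) = d(x) y + x T(y), where T = d + R_p
    and p is the value of the coalgebra morphism at (a, b). The f = d + R_q,
    with q primitive and d admitting such a T, form a Lie algebra containing
    all R_a (lie_subalgebra_pseudoderivable); hence every d in s_inn admits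
    such a T, necessarily equal to d + R_p with p = T(1) primitive
    (inner_pseudoderivation).

    The map zeta is d |-> R_p / 2, so that D = d + zeta(d) = (d + T) / 2.
    The identity on T reads T R_y = R_y d + R_(T y), which gives
      [D, R_y] = R_(T y) - (R_y R_p + R_p R_y) / 2      (bracket_average).
    For y = a primitive the right-hand side is a right multiplication, and a
    coderivation that is a right multiplication is some R_b with b primitive:
    hence d + zeta(d) normalises c. For y = a^n the left-hand side is also known
    to be a right multiplication, so R_a^n R_p + R_p R_a^n is one for every n.

    For the even iterated brackets of zeta(d), let L and R be the compositions
    with R_a on the left and on the right, two commuting operators, so that
    ad R_a = L - R. At X = R_p the polynomials L^n + R^n produce right
    multiplications, and so do the complete homogeneous polynomials h_n(L, R)
    at every Y in c. By induction on n, (L - R)^(2n) X lies in c,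
    because of an identity
      sum_(j <= n) c_j h_(2n-2j)(L, R) (L - R)^(2j) = L^(2n) + R^(2n)
    with c_n <> 0 (bernoulli_identity): it is the homogeneous form of the
    expansion of x coth x, its coefficients are multiples of the Bernoulli
    numbers B_(2j), and these do not vanish since 2 B_(2j) is a quotient of odd
    integers for j > 0 (bernoulli_neq0). *)

Set Implicit Arguments.
Unset Strict Implicit.
Unset Printing Implicit Defensive.

Import GRing.Theory.

Local Open Scope classical_set_scope.
Local Open Scope ring_scope.

(** * The ring of endomorphisms *)

Section EndomorphismRing.
Variables (k : fieldType) (V : lmodType k).
Implicit Types f g h : endo V.

Definition endo1 : endo V := idfun.

Fact endo_compA : associative (@endo_comp k V).
Proof. by move=> f g h; apply/endoP. Qed.
Fact endo_comp1f : left_id endo1 (@endo_comp k V).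
Proof. by move=> f; apply/endoP. Qed.
Fact endo_compf1 : right_id endo1 (@endo_comp k V).
Proof. by move=> f; apply/endoP. Qed.
Fact endo_compDl : left_distributive (@endo_comp k V) +%R.
Proof. by move=> f g h; apply/endoP. Qed.
Fact endo_compDr : right_distributive (@endo_comp k V) +%R.
Proof. by move=> f g h; apply/endoP => x; exact: linearD. Qed.

(** The ring structure is also used on the endomorphisms of endo U, among which
    the left and right compositions with a given map commute. *)
HB.instance Definition _ := GRing.Zmodule_isPzRing.Build (endo V)
  endo_compA endo_comp1f endo_compf1 endo_compDl endo_compDr.

Lemma endoME f g x : (f * g) x = f (g x). Proof. by []. Qed.

Lemma endo1E x : (1 : endo V) x = x. Proof. by []. Qed.

Lemma endoXE f n x : (f ^+ n) x = iter n f x.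
Proof. by elim: n => //= n IHn; rewrite exprS endoME IHn. Qed.

Lemma endoMnE f n x : (f *+ n) x = f x *+ n.
Proof. by elim: n => [|n IHn]; rewrite ?mulr0n // !mulrS endoDE IHn. Qed.

Lemma endo_sumE I (r : seq I) (P : pred I) (F : I -> endo V) x :
  (\sum_(i <- r | P i) F i) x = \sum_(i <- r | P i) F i x.
Proof. by elim/big_rec2: _ => // i y f _ <-. Qed.

Lemma endo_scaleAl (a : k) f g : a *: (f * g) = (a *: f) * g.
Proof. by apply/endoP. Qed.

Lemma endo_scaleAr (a : k) f g : a *: (f * g) = f * (a *: g).
Proof. by apply/endoP => x; exact/esym/(linearZ_LR f). Qed.

Lemma liebE f g : lieb f g = f * g - g * f. Proof. by []. Qed.

Lemma liebfE f g x : lieb f g x = f (g x) - g (f x). Proof. by []. Qed.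

End EndomorphismRing.

(** * Even and odd parts of the binomial expansion *)

Lemma big_nat_vanishing_tail (V : nmodType) (F : nat -> V) m n :
    (forall i, (minn m n <= i)%N -> F i = 0) ->
  \sum_(0 <= i < m) F i = \sum_(0 <= i < n) F i.
Proof.
wlog lemn : m n / (m <= n)%N => [IH F0|].
  case/orP: (leq_total m n) => le; first exact: IH.
  by symmetry; apply: IH => // i; rewrite minnC; exact: F0.
move=> F0; rewrite (big_nat_widen _ _ _ _ _ lemn) big_mkcond /=.
apply: eq_big_nat => i _; case: ltnP => // leim.
by rewrite F0 // geq_min leim.
Qed.

Section EvenOddBinomial.
Variable R : pzRingType.
Implicit Types s d a b : R.

Definition bin_even s d n :=
  \sum_(0 <= i < n.+1) (s ^+ (n - i.*2) * d ^+ i.*2) *+ 'C(n, i.*2).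

(** With a factor d removed, so that this is the quotient of
    (s + d)^n - (s - d)^n by 2d for commuting s and d. *)
Definition bin_odd s d n :=
  \sum_(0 <= i < n.+1) (s ^+ (n - i.*2.+1) * d ^+ i.*2) *+ 'C(n, i.*2.+1).

(** The complete homogeneous polynomial of degree n - 1 in a and b. *)
Definition geom2 a b n := \sum_(i < n) a ^+ (n.-1 - i) * b ^+ i.

(** Vanishing binomial coefficients let the two sums be written over any large
    enough range, as the recursions and the reindexings below require. *)
Lemma bin_even_widen s d n N : (n < N.*2)%N ->
  bin_even s d n =
  \sum_(0 <= i < N) (s ^+ (n - i.*2) * d ^+ i.*2) *+ 'C(n, i.*2).
Proof.
move=> ltnN; apply: big_nat_vanishing_tail => i; rewrite geq_min => iP.
by rewrite bin_small //; lia.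
Qed.

Lemma bin_odd_widen s d n N : (n <= N.*2)%N ->
  bin_odd s d n =
  \sum_(0 <= i < N) (s ^+ (n - i.*2.+1) * d ^+ i.*2) *+ 'C(n, i.*2.+1).
Proof.
move=> ltnN; apply: big_nat_vanishing_tail => i; rewrite geq_min => iP.
by rewrite bin_small //; lia.
Qed.

Lemma bin_evenS s d n :
  bin_even s d n.+1 = s * bin_even s d n + bin_odd s d n * d ^+ 2.
Proof.
rewrite (@bin_even_widen _ _ _ n.+2) ?(@bin_even_widen _ _ n n.+2); try lia.
rewrite /bin_odd mulr_suml mulr_sumr big_nat_recl //.
rewrite [X in _ = X + _]big_nat_recl //.
rewrite !subn0 !mulr1 !bin0 -exprS -addrA; congr (_ + _).
rewrite -big_split; apply: eq_big_nat => i _ /=.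
rewrite doubleS subSS binS mulrnDr addrC mulrnAl mulrnAr -mulrA -exprD addn2.
rewrite addrC; congr (_ + _); case: (leqP i.*2.+2 n) => lein; last first.
  by rewrite bin_small.
by rewrite mulrA -exprS; congr (_ ^+ _ * _ *+ _); lia.
Qed.

Lemma bin_oddS s d n :
  bin_odd s d n.+1 = s * bin_odd s d n + bin_even s d n.
Proof.
rewrite (@bin_odd_widen _ _ _ n.+1) ?(@bin_odd_widen _ _ n n.+1); try lia.
rewrite /bin_even mulr_sumr -big_split; apply: eq_big_nat => i _ /=.
rewrite subSS binS mulrnDr mulrnAr; congr (_ + _).
case: (leqP i.*2.+1 n) => lein; last by rewrite bin_small.
by rewrite mulrA -exprS; congr (_ ^+ _ * _ *+ _); lia.
Qed.

Lemma geom2S a b n : geom2 a b n.+1 = a * geom2 a b n + b ^+ n.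
Proof.
rewrite /geom2 big_ord_recr /= subnn mul1r mulr_sumr; congr (_ + _).
apply: eq_bigr => i _; rewrite mulrA -exprS; congr (_ ^+ _ * _).
by have := ltn_ord i; lia.
Qed.

Lemma geom2_1 a b : geom2 a b 1 = 1.
Proof. by rewrite /geom2 big_ord1 mulr1. Qed.

Section Commuting.
Variables (s d : R) (sd : GRing.comm s d).

Lemma comm_bin_odd n : GRing.comm d (bin_odd s d n).
Proof.
apply: commr_sum => i _; apply: commrMn; by apply: commrM; apply: commrX.
Qed.

Lemma exprD_even_odd n : (s + d) ^+ n = bin_even s d n + d * bin_odd s d n.
Proof.
elim: n => [|n IHn].
  by rewrite /bin_even /bin_odd !big_nat1 !bin0n /= mulr0 addr0 mulr1.
have dQ := comm_bin_odd n; rewrite exprS IHn bin_evenS bin_oddS.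
rewrite mulrDl !mulrDr [d * (d * _)]mulrA -expr2 -(commrX 2 (commr_sym dQ)).
rewrite !mulrA -sd -!addrA; congr (_ + _).
by rewrite addrA addrC.
Qed.

Lemma exprB_even_odd n : (s - d) ^+ n = bin_even s d n - d * bin_odd s d n.
Proof.
elim: n => [|n IHn].
  by rewrite /bin_even /bin_odd !big_nat1 !bin0n /= mulr0 subr0 mulr1.
have dQ := comm_bin_odd n; rewrite exprS IHn bin_evenS bin_oddS.
rewrite mulrBl !mulrBr mulrDr [d * (d * _)]mulrA -expr2.
rewrite -(commrX 2 (commr_sym dQ)) !mulrA -sd !opprD opprK.
by rewrite -!addrA; congr (_ + _); rewrite addrA addrC.
Qed.

Lemma expr_even n : (s + d) ^+ n + (s - d) ^+ n = bin_even s d n *+ 2.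
Proof. by rewrite exprD_even_odd exprB_even_odd addrACA subrr addr0 mulr2n. Qed.

(** Dividing (s + d)^n - (s - d)^n by the difference 2d is not allowed in a
    general ring; the recursion on n replaces the division. *)
Lemma geom2_odd n : geom2 (s + d) (s - d) n = bin_odd s d n.
Proof.
elim: n => [|n IHn]; first by rewrite /geom2 /bin_odd big_ord0 big_nat1.
rewrite geom2S IHn bin_oddS exprB_even_odd mulrDl -addrA; congr (_ + _).
by rewrite addrCA addrN addr0.
Qed.

End Commuting.
End EvenOddBinomial.

(** * An identity with Bernoulli coefficients *)

Lemma mul_bin_sub n m l : (l <= m)%N -> (m <= n)%N ->
  ('C(n, l) * 'C(n - l, m - l) = 'C(n, m) * 'C(m, l))%N.
Proof.
move=> llm lmn; apply/eqP.
have lln := leq_trans llm lmn.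
rewrite -(eqn_pmul2r (fact_gt0 l)) -(eqn_pmul2r (fact_gt0 (m - l))).
rewrite -(eqn_pmul2r (fact_gt0 (n - m))); apply/eqP.
have E1 := bin_fact llm; have E2 := bin_fact lmn; have E3 := bin_fact lln.
have := bin_fact (leq_sub2r l lmn).
rewrite subnBA // addnC addnBA // addKn => E4.
transitivity n`!.
  by rewrite -E3 -E4 !mulnA; ring.
by rewrite -E2 -E1; ring.
Qed.

Section Bernoulli.
Variables (k : fieldType) (char0 : [pchar k] =i pred0).

Lemma natf0 n : (n%:R == 0 :> k) = (n == 0)%N.
Proof. by move: n; apply/pcharf0P. Qed.

(** The solution of this triangular system is g j = 2 * 4^j * B_(2j), where
    B_(2j) is the Bernoulli number. Only finitely many terms are needed at a
    time, so the sequence is constrained up to n. *)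
Definition bernoulli_upto (g : nat -> k) n :=
  forall i, (i <= n)%N ->
  \sum_(0 <= j < i.+1) 'C(i.*2.+1, j.*2)%:R * g j = (2 * i.*2.+1)%:R.

Lemma bernoulli_ex n : exists g, bernoulli_upto g n.
Proof.
elim: n => [|n [g gP]].
  exists (fun=> 2%:R) => i; rewrite leqn0 => /eqP ->.
  by rewrite big_nat1 bin0 mul1r.
pose S := \sum_(0 <= j < n.+1) 'C(n.+1.*2.+1, j.*2)%:R * g j.
exists (fun j => if j == n.+1 then
  ((2 * n.+1.*2.+1)%:R - S) / n.+1.*2.+1%:R else g j) => i.
have E m : (m <= n)%N -> (m == n.+1) = false by lia.
rewrite leq_eqVlt => /predU1P[->|]; last first.
  rewrite ltnS => lein; rewrite -gP //; apply: eq_big_nat => j ji.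
  by rewrite E //; lia.
rewrite big_nat_recr //= eqxx -[X in 'C(_, X)]/(n.+1.*2) binSn.
rewrite [X in _ + X]mulrC divfK ?natf0 // addrC -[RHS](subrK S); congr (_ + _).
by apply: eq_big_nat => j jn; rewrite E //; lia.
Qed.

(** With s = L + R and d = L - R, this expresses L^(2n) + R^(2n) through the
    complete homogeneous polynomials in L and R times powers of (L - R)^2. In
    the basis s^(2n-2i) d^(2i), the trinomial revision mul_bin_sub turns the
    coefficient of the left-hand side into the sum that defines g. *)
Lemma bernoulli_identity (V : lmodType k) (s d : endo V) (g : nat -> k) n :
    GRing.comm s d -> bernoulli_upto g n ->
  \sum_(0 <= j < n.+1) ('C(n.*2.+1, j.*2)%:R * g j) *:
     (geom2 (s + d) (s - d) (n - j).*2.+1 * d ^+ j.*2) =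
  ((s + d) ^+ n.*2 + (s - d) ^+ n.*2) *+ n.*2.+1.
Proof.
move=> sd gP; rewrite expr_even //.
pose F j i := ('C(n.*2.+1, i.*2.+1)%:R * ('C(i.*2.+1, j.*2)%:R * g j)) *:
    (s ^+ (n - i).*2 * d ^+ i.*2).
transitivity (\sum_(0 <= j < n.+1) \sum_(0 <= i < n.+1 | (j <= i)%N) F j i).
  apply: eq_big_nat => j /= jn; rewrite geom2_odd //.
  rewrite (@bin_odd_widen _ _ _ _ (n.+1 - j)); last by lia.
  rewrite mulr_suml scaler_sumr.
  transitivity (\sum_(0 + j <= i < n.+1) F j i); last first.
    by rewrite add0n (big_nat_widenl _ 0).
  rewrite big_addn.
  apply: eq_big_nat => i /= iN; rewrite /F.
  rewrite [_ *+ _ * d ^+ _]mulrnAl -mulrA -exprD.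
  rewrite -scaler_nat scalerA mulrAC mulrA -!natrM -mul_bin_sub; try lia.
  have -> : (n - j).*2.+1 = (n.*2.+1 - j.*2)%N by lia.
  have -> : (i + j).*2.+1 = ((i.*2.+1) + j.*2)%N by lia.
  rewrite addnK; have -> : (i.*2 + j.*2 = (i + j).*2)%N by lia.
  by have -> : (n.*2.+1 - j.*2 - i.*2.+1 = (n - (i + j)).*2)%N by lia.
rewrite (exchange_big_dep_nat xpredT) //=.
rewrite (@bin_even_widen _ _ _ _ n.+1); last by lia.
rewrite -mulrnA -sumrMnl; apply: eq_big_nat => i /= iN.
transitivity (\sum_(0 <= j < i.+1) F j i).
  by rewrite [RHS](big_nat_widen _ _ n.+1).
rewrite -scaler_suml -mulr_sumr gP // -natrM scaler_nat -mulrnA -doubleB.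
congr (_ *+ _).
have := mul_bin_diag n.*2.+1 i.*2; rewrite /=; nia.
Qed.

Lemma geom2_r0 (R : pzRingType) (a : R) n : geom2 a 0 n.+1 = a ^+ n.
Proof.
rewrite /geom2 big_ord_recl subn0 mulr1 big1 ?addr0 // => i _.
by rewrite expr0n /= mulr0.
Qed.

(** The recursion 2-adically suited to B_(2j): it is bernoulli_identity at
    L = 1, R = 0, where every homogeneous polynomial takes the value 1. *)
Lemma bernoulli_sum (g : nat -> k) n : bernoulli_upto g n.+1 ->
  \sum_(0 <= j < n.+2) 'C(n.+1.*2.+1, j.*2)%:R * (g j / 4%:R ^+ j)
  = n.+1.*2.+1%:R.
Proof.
move=> gP; have c4 : 4%:R != 0 :> k by rewrite natf0.
have E24 m : 2%:R ^+ m.*2 = 4%:R ^+ m :> k by rewrite -mul2n exprM -natrX.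
(* s = d = 1 on the one-dimensional space, that is L = 1 and R = 0 *)
have := bernoulli_identity (commr1 (1 : endo k^o)) gP.
move/(congr1 (fun f : endo k^o => f 1)); rewrite endo_sumE subrr expr0n addr0.
rewrite endoMnE -mulr2n.
have X2 m : ((1 *+ 2 : endo k^o) ^+ m) 1 = 2%:R ^+ m.
  elim: m => // m IHm; rewrite exprS endoME IHm endoMnE endo1E.
  by rewrite exprS mulr_natl.
rewrite X2 => E; apply: (mulfI (expf_neq0 n.+1 c4)).
transitivity (2%:R ^+ n.+1.*2 *+ n.+1.*2.+1 : k); last first.
  by rewrite -[LHS]mulr_natr E24.
rewrite -E mulr_sumr; apply: eq_big_nat => j jn.
rewrite geom2_r0 expr1n mulr1 endoZE X2.
rewrite /GRing.scale /= E24.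
have -> : 4%:R ^+ n.+1 = 4%:R ^+ (n.+1 - j) * 4%:R ^+ j :> k.
  by rewrite -exprD subnK.
by field; rewrite expf_neq0.
Qed.

(** Reduction modulo 2 of the rational numbers with odd denominator, seen
    inside k. *)
Definition has_parity (e : bool) (x : k) :=
  exists (p : int) (q : nat), [/\ odd q, x * q%:R = p%:~R & odd `|p| = e].

Lemma has_parity_nat n : has_parity (odd n) n%:R.
Proof. by exists n%:Z, 1; rewrite mulr1. Qed.

Lemma has_parityB e f x y :
  has_parity e x -> has_parity f y -> has_parity (e (+) f) (x - y).
Proof.
case=> p [q [oq xE <-]] [p' [q' [oq' yE <-]]].
exists (p * q'%:Z - p' * q%:Z), (q * q')%N; split; first by rewrite oddM oq.
  by rewrite rmorphB !rmorphM /= -xE -yE -?pmulrn; ring.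
lia.
Qed.

Lemma has_parityD e f x y :
  has_parity e x -> has_parity f y -> has_parity (e (+) f) (x + y).
Proof.
move=> xP yP; rewrite -[y]opprK -[- y]sub0r -(addFb f).
exact: has_parityB xP (has_parityB (has_parity_nat 0) yP).
Qed.

Lemma has_parity_sum (c : nat -> nat) (b : nat -> k) m n :
    (forall j, (m <= j < n)%N -> has_parity true (b j)) ->
  has_parity (odd (\sum_(m <= j < n) c j)) (\sum_(m <= j < n) (c j)%:R * b j).
Proof.
move=> bP; rewrite !big_nat.
elim/big_rec2: _ => [|j y z /bP[p [q [oq bE op]]] IH].
  exact: has_parity_nat.
rewrite oddD; apply: has_parityD => //.
exists ((c j)%:Z * p), q; split=> //; last by rewrite abszM oddM op andbT.
by rewrite -mulrA bE rmorphM /= -pmulrn.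
Qed.

Lemma has_parity_neq0 x : has_parity true x -> x != 0.
Proof.
case=> p [q [oq xE op]]; apply/eqP => x0.
have : `|p|%:R = 0 :> k.
  apply/eqP; move: xE; rewrite x0 mul0r; case: (intP p) => [//|n|n] /eqP.
    by rewrite eq_sym -pmulrn.
  by rewrite eq_sym rmorphN oppr_eq0 abszN /= -pmulrn.
by move/eqP; rewrite natf0 => /eqP p0; rewrite p0 in op.
Qed.

Lemma sum_bin_even n : (\sum_(0 <= j < n.+2) 'C(n.+1.*2.+1, j.*2) = 4 ^ n.+1)%N.
Proof.
have := expr_even (commr1 (1 : int)) n.+1.*2.+1.
rewrite subrr [0 ^+ _]expr0n addr0 (@bin_even_widen _ _ _ _ n.+2); last by lia.
rewrite (eq_big_nat _ _ (F2 := fun j => 'C(n.+1.*2.+1, j.*2)%:R)); last first.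
  by move=> j _; rewrite !expr1n mulr1.
rewrite -natr_sum -mulrnA -[1 + 1]/(2%:R) -natrX => /eqP.
rewrite Num.Theory.eqr_nat.
by rewrite expnS -mul2n expnM mulnC eqn_pmul2r // => /eqP.
Qed.

(** By induction, g j / 4^j = 2 B_(2j) is a quotient of odd integers for j > 0:
    modulo 2, bernoulli_sum only involves a sum of binomial coefficients,
    which is even by sum_bin_even. *)
Lemma bernoulli_neq0 (g : nat -> k) n : bernoulli_upto g n -> g n != 0.
Proof.
case: n => [|n] gP.
  have := gP 0%N isT; rewrite big_nat1 bin0 mul1r => ->.
  by rewrite natf0.
suff : has_parity true (g n.+1 / 4%:R ^+ n.+1).
  by move/has_parity_neq0; apply: contra => /eqP->; rewrite mul0r.
elim/ltn_ind: n gP => n IHn gP; have := bernoulli_sum gP.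
rewrite big_nat_recl // big_nat_recr //= bin0 mul1r expr0 divr1.
have := gP 0%N isT; rewrite big_nat1 bin0 mul1r => ->.
rewrite -[X in 'C(_, X)]/n.+1.*2 binSn.
rewrite [_%:R * (_ / _)]mulrC addrA => /(canRL (addKr _)); rewrite opprD addrC.
set S := \sum_(_ <= _ < _) _ => E.
have SP : has_parity false S.
  have : has_parity (odd (\sum_(0 <= j < n) 'C(n.+1.*2.+1, j.+1.*2))) S.
    apply: has_parity_sum => j jn; apply: IHn; first by case/andP: jn.
    by move=> i lei; apply: gP; lia.
  have := sum_bin_even n; rewrite big_nat_recl // big_nat_recr //=.
  rewrite bin0 -[X in 'C(_, X)]/n.+1.*2 binSn => /(congr1 odd).
  rewrite !oddD oddX /=; set b := odd (\sum_(_ <= _ < _) _).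
  by rewrite odd_double; case: b.
have [p [q [oq xE op]]] :
    has_parity true (g n.+1 / 4%:R ^+ n.+1 * n.+1.*2.+1%:R).
  rewrite E addrA; apply: (@has_parityB true false) => //.
  apply: (@has_parityB true false); last exact: (has_parity_nat 2).
  by have := has_parity_nat n.+1.*2.+1; rewrite /= odd_double.
exists p, (n.+1.*2.+1 * q)%N; split=> //; last by rewrite natrM mulrA.
by rewrite oddM oq /= odd_double.
Qed.

End Bernoulli.

(** * Sweedler calculus and coderivations *)

Notation bilin := (bilinear_for *:%R *:%R).

Ltac linearize :=
  do ?[rewrite linearPl | rewrite linearPr | rewrite linearP].

Section SweedlerCalculus.
Variables (k : fieldType) (U V W : lmodType k).

(** Linearity in the summand holds on any chosen decomposition of t, whether or
    not the summands are bilinear. *)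
Lemma sweedler_linearf (c : k) (f g : U -> V -> W) t :
  \sw_(a, b <- t) (c *: f a b + g a b) = c *: sweedler f t + sweedler g t.
Proof. by rewrite /sweedler big_split scaler_sumr. Qed.

Lemma eq_sweedler (f g : U -> V -> W) t :
  (forall u v, f u v = g u v) -> sweedler f t = sweedler g t.
Proof. by move=> fg; apply: eq_bigr. Qed.

Lemma linear_sweedler (W' : lmodType k) (h : {linear W -> W'})
    (f : U -> V -> W) t :
  h (sweedler f t) = \sw_(a, b <- t) h (f a b).
Proof. exact: linear_sum. Qed.

Lemma bilin_sweedler (U' V' : lmodType k) (F : U' -> V' -> U -> V -> W) t :
    (forall u v, bilin (fun u' v' => F u' v' u v)) ->
  bilin (fun u' v' => sweedler (F u' v') t).
Proof.
move=> FP; split=> [v'|u'] c x y /=; rewrite -sweedler_linearf;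
  apply: eq_sweedler => u v; have [Fl Fr] := FP u v; [exact: Fl|exact: Fr].
Qed.

Lemma tensor_ext (F G : {linear tensor U V -> W}) :
  (forall u v, F (u \ox v) = G (u \ox v)) -> F =1 G.
Proof.
move=> FG; elim/tensor_ind => [|u v x IH]; first by rewrite !linear0.
by rewrite !linearD FG IH.
Qed.

End SweedlerCalculus.

Definition mk_linear (k : fieldType) (V W : lmodType k) (f : V -> W)
  (fP : linear f) : {linear V -> W} :=
  HB.pack f (GRing.isLinear.Build k V W *:%R f fP).

Lemma sweedler_sum (k : fieldType) (U V W : lmodType k) (f : U -> V -> W)
    I (r : seq I) (P : pred I) (u : I -> U) (v : I -> V) (c : I -> nat) :
  bilin f -> sweedler f (\sum_(i <- r | P i) (u i \ox v i) *+ c i) =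
             \sum_(i <- r | P i) f (u i) (v i) *+ c i.
Proof.
move=> fP; rewrite -[sweedler f]/(mk_linear (sweedler_linear fP) : _ -> _).
rewrite linear_sum; apply: eq_bigr => i _.
by rewrite raddfMn /= sweedler_tens.
Qed.

Section Coderivations.
Variables (k : fieldType) (U : bialgType k).
Implicit Types (f g : endo U) (a b u x y : U).
Local Notation R := (@rmul k U).

Lemma rmulE a x : R a x = x *h a. Proof. by []. Qed.

Lemma rmulP (c : k) a b : R (c *: a + b) = c *: R a + R b.
Proof. by apply/endoP => x; rewrite rmulE linearPr. Qed.

Lemma sweedler_prim (W : lmodType k) (f : U -> U -> W) a :
  bilin f -> Prim a -> sweedler f (comul a) = f a 1h + f 1h a.
Proof.
move=> fP aP; rewrite aP -[a \ox 1h]scale1r sweedler_linear //.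
rewrite !sweedler_tens //.
by rewrite scale1r.
Qed.

Lemma sweedler_one (W : lmodType k) (f : U -> U -> W) :
  bilin f -> sweedler f (comul 1h) = f 1h 1h.
Proof. by move=> fP; rewrite comul1 sweedler_tens. Qed.

Fact leibniz_bilin f : bilin (fun u v : U => f u \ox v + u \ox f v).
Proof.
by split=> ? ? ? ? /=; linearize; rewrite scalerDr addrACA.
Qed.

(** The operator f (x) 1 + 1 (x) f on the tensor square: f is a coderivation
    when comultiplication intertwines f with it. *)
Definition leibniz f : endo (tensor U U) :=
  mk_linear (sweedler_linear (leibniz_bilin f)).

Lemma leibniz_tens f u v : leibniz f (u \ox v) = f u \ox v + u \ox f v.
Proof. exact: (sweedler_tens (leibniz_bilin f)). Qed.

Lemma coderE f : coder f <-> forall u, comul (f u) = leibniz f (comul u).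
Proof. by []. Qed.

Lemma coderP (c : k) f g : coder f -> coder g -> coder (c *: f + g).
Proof.
rewrite !coderE => fP gP u; rewrite endoDE endoZE linearP fP gP.
rewrite -sweedler_linearf; apply: eq_sweedler => x y.
rewrite !endoDE !endoZE; linearize; by rewrite scalerDr addrACA.
Qed.

Lemma coder0 : coder (0 : endo U).
Proof.
move=> u; rewrite linear0; symmetry; apply: big1 => p _ /=.
by rewrite linear0l linear0r addr0.
Qed.

Lemma leibniz_bracket f g t :
  leibniz (lieb f g) t = leibniz f (leibniz g t) - leibniz g (leibniz f t).
Proof.
apply: (tensor_ext (F := leibniz (lieb f g))
                   (G := lieb (leibniz f) (leibniz g))).
move=> u v; rewrite !liebE.
rewrite [RHS]endoDE [in RHS]endoNE !endoME !leibniz_tens !linearD.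
rewrite !leibniz_tens.
rewrite !endoDE !endoNE !endoME /= linearDl linearDr linearNl linearNr /=.
rewrite !opprD.
rewrite [f u \ox g v + _]addrC [X in _ = X + _]addrACA.
rewrite [- (g u \ox f v) - _]addrC [X in _ = _ + X]addrACA -opprD.
rewrite [g u \ox _ + _]addrC.
by rewrite -[- (f u \ox g v) - _]opprD [RHS]addrACA subrr addr0 opprD addrACA.
Qed.

Lemma coder_bracket f g : coder f -> coder g -> coder (lieb f g).
Proof.
rewrite !coderE => fP gP u; rewrite leibniz_bracket liebfE linearB.
by rewrite !(fP, gP).
Qed.

Lemma coder_Prim f : coder f -> Prim (f 1h).
Proof.
move=> /(_ 1h); rewrite sweedler_one //; exact: leibniz_bilin.
Qed.

Lemma coder_rmul a : Prim a -> coder (R a).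
Proof.
move=> aP u; rewrite rmulE comulM; apply: eq_sweedler => u1 u2.
rewrite sweedler_prim // ?hmul1r // ; split=> ? ? ? ? /=; by linearize.
Qed.

Lemma rmul1 a : R a 1h = a. Proof. exact: hmul1l. Qed.

Definition rmuls : set (endo U) := [set R a | a in setT].

(** This is how every membership in c is obtained: a right multiplication
    R_a is recovered from its value a at 1, and the value at 1 of a
    coderivation is primitive. *)
Lemma coder_rmuls f : coder f -> rmuls f -> rprim f.
Proof.
by move=> fP [a _ fE]; exists a => //; rewrite -(rmul1 a) fE; exact: coder_Prim.
Qed.

Lemma rprim_coder f : rprim f -> coder f.
Proof. by case=> a aP <-; exact: coder_rmul. Qed.

Lemma subspace_rmuls : subspace rmuls.
Proof.
split=> [|c _ _ [a _ <-] [b _ <-]]; last by exists (c *: a + b); rewrite ?rmulP.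
by exists 0 => //; apply/endoP => x; rewrite rmulE linear0r.
Qed.

Lemma PrimP (c : k) a b : Prim a -> Prim b -> Prim (c *: a + b).
Proof.
rewrite /Prim /= => aP bP; rewrite linearP aP bP; linearize.
by rewrite scalerDr addrACA.
Qed.

Lemma subspace_rprim : subspace (@rprim k U).
Proof.
split=> [|c _ _ [a aP <-] [b bP <-]].
  apply: coder_rmuls; [exact: coder0|exact: (subspace_rmuls).1].
by exists (c *: a + b); rewrite ?rmulP //; exact: PrimP.
Qed.

Lemma counit_Prim a : Prim a -> counit a = 0.
Proof.
move=> aP; have := counitl a; rewrite sweedler_prim //; last first.
  split=> ? ? ? ? /=; rewrite ?linearP /= ?scalerDr ?scalerDl !scalerA //;
  by rewrite mulrC.
rewrite counit1 scale1r -[RHS]add0r => /addIr /(congr1 counit).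
by rewrite linearZ linear0 /= counit1 mulr1.
Qed.

Lemma lie_subalgebra_coder : lie_subalgebra (@coder k U).
Proof.
split; last exact: coder_bracket.
by split; [exact: coder0|exact: coderP].
Qed.

End Coderivations.

(** * Polarisation of powers *)

Section Subspaces.
Variables (k : fieldType) (V : lieAlgType k) (S : set V) (Ssub : subspace S).

Lemma subspace0 : S 0. Proof. exact: Ssub.1. Qed.

Lemma subspaceD x y : S x -> S y -> S (x + y).
Proof. by move=> Sx Sy; rewrite -[x]scale1r; exact: Ssub.2. Qed.

Lemma subspaceZ (c : k) x : S x -> S (c *: x).
Proof.
move=> Sx; rewrite -[_ *: _]addr0; apply: Ssub.2 => //; exact: subspace0.
Qed.

Lemma subspaceB x y : S x -> S y -> S (x - y).
Proof. by move=> Sx Sy; rewrite -scaleN1r; apply/subspaceD/subspaceZ. Qed.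

Lemma subspaceZr (c : k) x : c != 0 -> S (c *: x) -> S x.
Proof. by move=> c0 /(subspaceZ c^-1); rewrite scalerA mulVf // scale1r. Qed.

Lemma subspaceMn n x : S x -> S (x *+ n).
Proof. by rewrite -scaler_nat; exact: subspaceZ. Qed.

Lemma subspace_sum I (r : seq I) (P : pred I) (F : I -> V) :
  (forall i, P i -> S (F i)) -> S (\sum_(i <- r | P i) F i).
Proof.
by move=> SF; apply: big_ind => //; [exact: subspace0|exact: subspaceD].
Qed.

(** Induction on n: for a polynomial p of degree n, p(2t) - 2^n p(t) loses the
    top coefficient, and its j-th coefficient is that of p times 2^j - 2^n,
    which is nonzero in characteristic zero. *)
Lemma subspace_coef (char0 : [pchar k] =i pred0) (w : nat -> V) n :
    (forall t : k, S (\sum_(j < n) t ^+ j *: w j)) ->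
  forall j, (j < n)%N -> S (w j).
Proof.
elim: n w => // n IHn w wP.
have lt j : (j < n)%N -> S (w j).
  move=> jn; have c0 : 2%:R ^+ j - 2%:R ^+ n != 0 :> k.
    rewrite subr_eq0 -!natrX -(subnK (ltnW jn)) expnD natrM -subr_eq0.
    rewrite -[X in X - _]mul1r -mulrBl mulf_eq0 subr_eq0 natf0 //.
    rewrite expn_eq0 /= orbF eq_sym -subr_eq0 -[1]/(1%:R) -natrB ?expn_gt0 //.
    by rewrite natf0 // subn_eq0 -ltnNge -{1}(expn0 2) ltn_exp2l // subn_gt0.
  apply: subspaceZr c0 _.
  apply: (IHn (fun j => (2%:R ^+ j - 2%:R ^+ n) *: w j)) jn => t.
  have := subspaceB (wP (2%:R * t)) (subspaceZ (2%:R ^+ n) (wP t)).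
  rewrite !big_ord_recr /= scalerDr opprD addrACA scalerA exprMn subrr addr0.
  rewrite scaler_sumr -sumrB; congr S; apply: eq_bigr => i _.
  by rewrite !scalerA -scalerBl; congr (_ *: _); rewrite exprMn; ring.
move=> j; rewrite ltnS leq_eqVlt => /predU1P[->|]; last exact: lt.
have := wP 1; rewrite big_ord_recr /= expr1n scale1r => wS.
rewrite -[w n](addKr (\sum_(i < n) 1 ^+ i *: w i)) addrC.
apply: subspaceB => //.
by apply: subspace_sum => i _; apply/subspaceZ/lt.
Qed.

End Subspaces.

Section LeftRight.
Variables (k : fieldType) (V : lmodType k).
Implicit Types f g A B : endo V.

Fact lmul_linear A : linear (fun f : endo V => A * f).
Proof. by move=> c f g; rewrite mulrDr endo_scaleAr. Qed.
Fact rmul_linear A : linear (fun f : endo V => f * A).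
Proof. by move=> c f g; rewrite mulrDl endo_scaleAl. Qed.

Definition lact A : endo (endo V) := mk_linear (lmul_linear A).
Definition ract A : endo (endo V) := mk_linear (rmul_linear A).

Lemma lactE A f : lact A f = A * f. Proof. by []. Qed.

Lemma ractE A f : ract A f = f * A. Proof. by []. Qed.

Lemma lactX A n f : (lact A ^+ n) f = A ^+ n * f.
Proof.
by elim: n => [|n IHn]; rewrite ?mul1r // !exprS endoME IHn lactE mulrA.
Qed.

Lemma ractX A n f : (ract A ^+ n) f = f * A ^+ n.
Proof.
elim: n => [|n IHn]; rewrite ?mulr1 // exprS exprSr endoME IHn.
by rewrite ractE mulrA.
Qed.

Lemma comm_lract A B : GRing.comm (lact A) (ract B).
Proof. by apply/endoP => f; rewrite !endoME !lactE !ractE mulrA. Qed.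

(** The coefficient of t in (A + t B)^n. *)
Definition sandwich A n B := geom2 (lact A) (ract A) n B.

Lemma sandwichS A n B : sandwich A n.+1 B = A * sandwich A n B + B * A ^+ n.
Proof. by rewrite /sandwich geom2S endoDE endoME ractX. Qed.

Lemma sandwich2 A B : sandwich A 2 B = A * B + B * A.
Proof.
by rewrite /sandwich /geom2 !big_ord_recr big_ord0 /= add0r.
Qed.

Lemma bracket_exp A D n : lieb D (A ^+ n) = sandwich A n (lieb D A).
Proof.
elim: n => [|n IHn].
  by rewrite liebE expr0 mulr1 mul1r subrr /sandwich /geom2 big_ord0.
rewrite sandwichS -IHn !liebE exprS mulrBl mulrBr !mulrA.
by rewrite [RHS]addrC addrA subrK.
Qed.

(** The sum runs up to degree n + 1 so that w 1 is part of it even for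
    n = 0. *)
Lemma exp_perturbation A B n : exists w : nat -> endo V,
  [/\ forall t : k, (A + t *: B) ^+ n = \sum_(j < n.+2) t ^+ j *: w j,
      w 0%N = A ^+ n, w 1%N = sandwich A n B & forall j, (n < j)%N -> w j = 0].
Proof.
elim: n => [|n [w [wP w0 w1 wn]]].
  exists (fun j => if j is 0%N then 1 else 0); split=> //.
  - by move=> t; rewrite !big_ord_recr big_ord0 /= scaler0 addr0 add0r scale1r.
  - by rewrite /sandwich /geom2 big_ord0.
  - by case.
exists (fun j => A * w j + if j is j'.+1 then B * w j' else 0); split.
- move=> t; rewrite exprS wP mulrDl.
  under [RHS]eq_bigr do rewrite scalerDr.
  rewrite big_split; congr (_ + _).
    rewrite [RHS]big_ord_recr /= wn // mulr0 scaler0 addr0 mulr_sumr.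
    by apply: eq_bigr => j _; rewrite endo_scaleAr.
  rewrite [RHS]big_ord_recl /= scaler0 add0r mulr_sumr; apply: eq_bigr => j _.
  by rewrite -endo_scaleAr -endo_scaleAl scalerA exprSr.
- by rewrite w0 addr0 exprS.
- by rewrite w1 w0 sandwichS.
- by case=> // j jn; rewrite !wn ?mulr0 ?addr0 //; lia.
Qed.

End LeftRight.

(** * Right monoalternativity on primitive elements *)

Section Monoalternative.
Variables (k : fieldType) (char0 : [pchar k] =i pred0).
Variables (U : bialgType k).
Local Notation R := (@rmul k U).

Fact ltens_bilin (f : endo U) : bilin (fun u v : U => f u \ox v).
Proof. by split=> ? ? ? ? /=; linearize. Qed.
Fact rtens_bilin (f : endo U) : bilin (fun u v : U => u \ox f v).
Proof. by split=> ? ? ? ? /=; linearize. Qed.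
Definition ltens f : endo (tensor U U) :=
  mk_linear (sweedler_linear (ltens_bilin f)).
Definition rtens f : endo (tensor U U) :=
  mk_linear (sweedler_linear (rtens_bilin f)).

Lemma ltensE f u v : ltens f (u \ox v) = f u \ox v.
Proof. exact: sweedler_tens (ltens_bilin f) _ _. Qed.
Lemma rtensE f u v : rtens f (u \ox v) = u \ox f v.
Proof. exact: sweedler_tens (rtens_bilin f) _ _. Qed.

Lemma comm_lrtens f g : GRing.comm (ltens f) (rtens g).
Proof.
apply/endoP => t; rewrite !endoME.
apply: (tensor_ext (F := ltens f * rtens g) (G := rtens g * ltens f)) => u v.
by rewrite !endoME !(ltensE, rtensE).
Qed.

Lemma leibnizE f : leibniz f = ltens f + rtens f.
Proof.
apply/endoP; apply: tensor_ext => u v.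
by rewrite leibniz_tens endoDE ltensE rtensE.
Qed.

Definition rpow a n := (R a ^+ n) 1h.

Lemma rmulX_rpow a m n : (R a ^+ m) (rpow a n) = rpow a (m + n).
Proof. by rewrite /rpow exprD. Qed.

(** Comultiplication intertwines R_a with R_a (x) 1 + 1 (x) R_a, whose powers
    are given by the binomial formula since the two summands commute. *)
Lemma comul_rpow a n : Prim a -> comul (rpow a n) =
  \sum_(i < n.+1) (rpow a (n - i) \ox rpow a i) *+ 'C(n, i).
Proof.
move=> aP; have lX m u v : (ltens (R a) ^+ m) (u \ox v) = (R a ^+ m) u \ox v.
  by elim: m => // m IHm; rewrite !exprS !endoME IHm ltensE.
have rX m u v : (rtens (R a) ^+ m) (u \ox v) = u \ox (R a ^+ m) v.
  by elim: m => // m IHm; rewrite !exprS !endoME IHm rtensE.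
transitivity ((leibniz (R a) ^+ n) (1h \ox 1h)).
  elim: n => [|n IHn]; first exact: comul1.
  by rewrite /rpow !exprS !endoME -IHn (coder_rmul aP).
rewrite leibnizE exprDn_comm; last exact: comm_lrtens.
by rewrite endo_sumE; apply: eq_bigr => i _; rewrite endoMnE endoME rX lX.
Qed.

Hypothesis mono : forall x y : U,
  \sw_(a, b <- comul y) ((x *h a) *h b) = \sw_(a, b <- comul y) (x *h (a *h b)).

(** Twofold monoalternativity at y = a^n is enough. By induction the terms with
    0 < i < n are multiples of R_a^n x on one side and of x a^n on the other,
    with the same coefficients, and the two extreme terms agree. *)
Lemma rmul_rpow a n : Prim a -> R (rpow a n) = R a ^+ n.
Proof.
move=> aP; elim/ltn_ind: n => -[|[|n]] IHn.
- by apply/endoP => x; rewrite rmulE hmul1r.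
- by rewrite /rpow !expr1 rmul1.
apply/endoP => x; rewrite rmulE; set m := n.+2.
pose z := x *h rpow a m - (R a ^+ m) x.
suff : z = 0 by move/subr0_eq.
have := mono x (rpow a m); rewrite comul_rpow //.
have biL : bilin (fun u v => (x *h u) *h v) by split=> ? ? ? ? /=; linearize.
have biR : bilin (fun u v => x *h (u *h v)) by split=> ? ? ? ? /=; linearize.
rewrite !sweedler_sum //.
move/esym/eqP; rewrite -subr_eq0 -sumrB => /eqP E.
have {E} : \sum_(i < m.+1) z *+ (if (0 < i < m)%N then 'C(m, i) else 0%N) = 0.
  rewrite -[RHS]E; apply: eq_bigr => i _.
  rewrite -mulrnBl.
  have lei : (i <= m)%N by rewrite -ltnS.
  case: ltnP => i0 /=; last first.
    move: i0; rewrite leqn0 => /eqP->; rewrite subn0 /rpow expr0 !hmul1r.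
    by rewrite subrr mul0rn.
  case: ltnP => im; last first.
    have -> : i = m :> nat by apply/eqP; rewrite eqn_leq lei.
    by rewrite subnn /rpow expr0 hmul1r hmul1l subrr mul0rn.
  congr (_ *+ _); rewrite -!rmulE !IHn //; last by rewrite -/m ltn_subrL i0.
  by rewrite rmulX_rpow subnKC // -!endoME -exprD subnKC.
rewrite sumrMnr => /eqP; rewrite -scaler_nat scaler_eq0 natf0 //.
case/orP=> [|/eqP//].
(* the coefficient is nonzero because its term i = 1 is n + 2 *)
by rewrite sum_nat_eq0 => /forallP/(_ (inord 1)); rewrite /= inordK // bin1.
Qed.

(** Every power of R_(a + t b) = R_a + t R_b is a right multiplication, hence so
    is its coefficient of t. *)
Lemma sandwich_rmuls a b n : Prim a -> Prim b -> rmuls (sandwich (R a) n (R b)).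
Proof.
move=> aP bP; have [w [wP _ <- _]] := exp_perturbation (R a) (R b) n.
apply: (subspace_coef (@subspace_rmuls _ U) char0 (n := n.+2)) => // t.
rewrite -wP addrC -rmulP -rmul_rpow; last exact: PrimP.
by exists (rpow (t *: b + a) n).
Qed.

End Monoalternative.

(** * Right pseudospeciality on primitive elements *)

Section HopfAlgebra.
Variables (k : fieldType) (U : hopfType k).
Implicit Types a b u v x y : U.
Local Notation R := (@rmul k U).

(** The threefold comultiplication hidden in the definition carries a counit on
    its first factor. *)
Lemma right_monoalternative2 : right_monoalternative U -> forall x y : U,
  \sw_(a, b <- comul y) ((x *h a) *h b) = \sw_(a, b <- comul y) (x *h (a *h b)).
Proof.
move=> mono x y.
have E (F : U -> U -> U) (FP : bilin F) :
    \sw_(a, b <- comul y) \sw_(a1, a2 <- comul a) (counit a1 *: F a2 b) =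
    \sw_(a, b <- comul y) F a b.
  apply: eq_sweedler => a b; rewrite -[in RHS](counitl a).
  pose Fb : {linear U -> U} := mk_linear (FP.1 b).
  rewrite -[F _ b]/(Fb _) linear_sweedler.
  by apply: eq_sweedler => a1 a2; rewrite linearZ.
have := mono x y 2%N; rewrite /= !E //; by split=> ? ? ? ? /=; linearize.
Qed.

Lemma sweedler_prim2 (W : lmodType k) (F : U -> U -> U -> U -> W) a b :
    (forall v1 v2, bilin (fun u1 u2 => F u1 u2 v1 v2)) ->
    (forall u1 u2, bilin (F u1 u2)) -> Prim a -> Prim b ->
  \sw_(u1, u2 <- comul a) \sw_(v1, v2 <- comul b) F u1 u2 v1 v2 =
  F a 1h b 1h + F a 1h 1h b + (F 1h a b 1h + F 1h a 1h b).
Proof.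
move=> Fu Fv aP bP; rewrite sweedler_prim //; last exact: bilin_sweedler.
by rewrite !sweedler_prim.
Qed.

Fact rmap_kernel_l x v1 v2 :
  bilin (fun u1 u2 => ((x *h u1) *h v1) /h (u2 *h v2)).
Proof. by split=> ? ? ? ? /=; linearize. Qed.

Fact rmap_kernel_r x u1 u2 :
  bilin (fun v1 v2 => ((x *h u1) *h v1) /h (u2 *h v2)).
Proof. by split=> ? ? ? ? /=; linearize. Qed.

Lemma rmapPl (c : k) u u' v x :
  rmap (c *: u + u') v x = c *: rmap u v x + rmap u' v x.
Proof.
rewrite /rmap linearP sweedler_linear //; apply: bilin_sweedler => v1 v2.
exact: rmap_kernel_l.
Qed.

Lemma rmapPr (c : k) u v v' x :
  rmap u (c *: v + v') x = c *: rmap u v x + rmap u v' x.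
Proof.
rewrite /rmap -sweedler_linearf; apply: eq_sweedler => u1 u2.
by rewrite linearP sweedler_linear //; exact: rmap_kernel_r.
Qed.

Lemma rmap1l v x : rmap 1h v x = counit v *: x.
Proof.
rewrite /rmap sweedler_one; last first.
  by apply: bilin_sweedler => v1 v2; exact: rmap_kernel_l.
by rewrite -rdivK; apply: eq_sweedler => v1 v2; rewrite hmul1r hmul1l.
Qed.

Lemma rmap1r u x : rmap u 1h x = counit u *: x.
Proof.
rewrite -rdivK; apply: eq_sweedler => u1 u2.
by rewrite sweedler_one ?hmul1r //; exact: rmap_kernel_r.
Qed.

Lemma rdiv1 x : x /h 1h = x.
Proof.
have := rdivK x (1h : U); rewrite sweedler_one ?hmul1r ?counit1 ?scale1r //.
by split=> ? ? ? ? /=; linearize.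
Qed.

(** Among the four terms of rmap a b x, all but (xa)b also occur when the
    division axiom (x v1) / v2 = 0 is expanded at v = ab; the remaining term
    there is x (ab). *)
Lemma rmap_Prim a b x : Prim a -> Prim b ->
  rmap a b x = (x *h a) *h b - x *h (a *h b).
Proof.
move=> aP bP; rewrite /rmap sweedler_prim2 //; last 2 first.
- exact: rmap_kernel_l.
- exact: rmap_kernel_r.
have bi : bilin (fun v1 v2 : U => (x *h v1) /h v2).
  by split=> ? ? ? ? /=; linearize.
have := rdivK x (a *h b); rewrite counitM (counit_Prim aP) mul0r scale0r.
rewrite -rmulE ((coderE _).1 (coder_rmul bP)) aP.
rewrite linearD !leibniz_tens !rmulE.
pose f := mk_linear (sweedler_linear bi).
rewrite -[sweedler _ _]/(f _) !linearD /= !sweedler_tens //.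
rewrite !hmul1l !hmul1r !rdiv1 -!addrA => /(canRL (addKr _)).
by rewrite addr0 => ->; rewrite addrC.
Qed.

Section Pseudospecial.
Variable m : {linear tensor U U -> U}.
Hypothesis m_morph : coalgebra_morphism2 m.
Hypothesis m1l : forall u : U, m (1h \ox u) = counit u *: 1h.
Hypothesis m1r : forall u : U, m (u \ox 1h) = counit u *: 1h.
Hypothesis m_pseudo : forall u v x y : U, Pmap m u v (x *h y) =
  \sw_(u1, u2 <- comul u) \sw_(v1, v2 <- comul v)
    (rmap u1 v1 x *h Pmap m u2 v2 y).

Fact Pmap_kernel_l x v1 v2 : bilin (fun u1 u2 => rmap u1 v1 x *h m (u2 \ox v2)).
Proof. by split=> ? ? ? ? /=; rewrite ?rmapPl; linearize. Qed.

Fact Pmap_kernel_r x u1 u2 : bilin (fun v1 v2 => rmap u1 v1 x *h m (u2 \ox v2)).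
Proof. by split=> ? ? ? ? /=; rewrite ?rmapPr; linearize. Qed.

Lemma PmapPl (c : k) u u' v x :
  Pmap m (c *: u + u') v x = c *: Pmap m u v x + Pmap m u' v x.
Proof.
rewrite /Pmap linearP sweedler_linear //; apply: bilin_sweedler => v1 v2.
exact: Pmap_kernel_l.
Qed.

Lemma PmapPr (c : k) u v v' x :
  Pmap m u (c *: v + v') x = c *: Pmap m u v x + Pmap m u v' x.
Proof.
rewrite /Pmap -sweedler_linearf; apply: eq_sweedler => u1 u2.
by rewrite linearP sweedler_linear //; exact: Pmap_kernel_r.
Qed.

Lemma Pmap11 x : Pmap m 1h 1h x = x.
Proof.
rewrite /Pmap !sweedler_one.
- by rewrite rmap1l m1l counit1 !scale1r hmul1r.
- exact: Pmap_kernel_r.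
- by apply: bilin_sweedler => v1 v2; exact: Pmap_kernel_l.
Qed.

Lemma Pmap_Prim a b x : Prim a -> Prim b ->
  Pmap m a b x = rmap a b x + x *h m (a \ox b).
Proof.
move=> aP bP; rewrite /Pmap sweedler_prim2 //; last 2 first.
- exact: Pmap_kernel_l.
- exact: Pmap_kernel_r.
rewrite rmap1r !rmap1l m1l !counit1 (counit_Prim aP) (counit_Prim bP).
by rewrite !scale0r !scale1r !linear0l hmul1r addr0 add0r.
Qed.

(** Of the four terms given by the comultiplications of a and b, two vanish
    because rmap a 1 = 0 and rmap 1 b = 0. *)
Lemma rmap_pseudoderivation a b x y : Prim a -> Prim b ->
  Pmap m a b (x *h y) = rmap a b x *h y + x *h Pmap m a b y.
Proof.
move=> aP bP; rewrite m_pseudo sweedler_prim2 //.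
- rewrite rmap1r !rmap1l counit1 (counit_Prim aP) (counit_Prim bP).
  by rewrite !scale0r !scale1r !linear0l Pmap11 addr0 add0r.
- by split=> ? ? ? ? /=; rewrite ?rmapPl ?PmapPl; linearize.
- by split=> ? ? ? ? /=; rewrite ?rmapPr ?PmapPr; linearize.
Qed.

Lemma Prim_morphism a b : Prim a -> Prim b -> Prim (m (a \ox b)).
Proof.
move=> aP bP; rewrite /Prim /= m_morph.1 sweedler_prim2 //.
- rewrite !m1r !m1l !counit1 (counit_Prim aP) (counit_Prim bP).
  by rewrite !scale0r !scale1r !linear0l addr0 add0r.
- by split=> ? ? ? ? /=; linearize.
- by split=> ? ? ? ? /=; linearize.
Qed.

End Pseudospecial.
End HopfAlgebra.

(** * Pseudoderivations *)

Section PseudoDerivations.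
Variables (k : fieldType) (U : bialgType k).
Implicit Types d T : endo U.
Local Notation R := (@rmul k U).

(** Infinitesimal version of a pseudoautomorphism: T = d + R_p, where p = T(1)
    is the companion of d. Keeping T rather than p makes the closure under
    brackets immediate. *)
Definition pseudoderivation d T :=
  [/\ coder d, coder T & forall x y, T (x *h y) = d x *h y + x *h T y].

Lemma pseudoderivationE d T : pseudoderivation d T -> T = d + R (T 1h).
Proof.
by case=> _ _ dT; apply/endoP => x; rewrite -[in LHS](hmul1r x) dT hmul1r.
Qed.

Lemma pseudoderivation_rmul d T y :
  pseudoderivation d T -> T * R y = R y * d + R (T y).
Proof. by case=> _ _ dT; apply/endoP => x; rewrite endoME rmulE dT. Qed.

Lemma pseudoderivationP (c : k) d T d' T' :
    pseudoderivation d T -> pseudoderivation d' T' ->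
  pseudoderivation (c *: d + d') (c *: T + T').
Proof.
case=> dP TP dT [d'P T'P d'T']; split; try exact: coderP.
move=> x y; rewrite !endoDE !endoZE dT d'T'; linearize.
by rewrite scalerDr addrACA.
Qed.

Lemma pseudoderivation0 : pseudoderivation 0 0.
Proof.
split; try exact: coder0.
by move=> x y; rewrite linear0l linear0r addr0.
Qed.

Lemma pseudoderivation_bracket d T d' T' :
    pseudoderivation d T -> pseudoderivation d' T' ->
  pseudoderivation (lieb d d') (lieb T T').
Proof.
case=> dP TP dT [d'P T'P d'T']; split; try exact: coder_bracket.
move=> x y; rewrite !liebfE d'T' dT (linearD T) (linearD T') !dT !d'T'.
rewrite linearBl linearBr /= !opprD.
rewrite [d x *h T' y + _]addrC [X in X + _ = _]addrACA.
rewrite [- (d' x *h T y) - _]addrC [X in _ + X = _]addrACA.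
rewrite -[- (d x *h T' y) - _]opprD [d x *h T' y + _]addrC.
by rewrite [LHS]addrACA subrr addr0 addrACA.
Qed.

End PseudoDerivations.

(** * Pseudoderivations of the inner algebra *)

Section InnerStructure.
Variables (k : fieldType) (char0 : [pchar k] =i pred0).
Variable U : bialgType k.
Local Notation R := (@rmul k U).

Hypothesis sandwichP : forall (a b : U) n,
  Prim a -> Prim b -> rmuls (sandwich (R a) n (R b)).

Let two0 : 2%:R != 0 :> k. Proof. by rewrite natf0. Qed.
Let rmuls_sub := @subspace_rmuls k U.
Let coder_sub := (@lie_subalgebra_coder k U).1.

Lemma rmuls_anticomm (a b : U) :
  Prim a -> Prim b -> rmuls (R a * R b + R b * R a).
Proof. by move=> aP bP; rewrite -sandwich2; exact: sandwichP. Qed.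

Definition associator_op (a b : U) : endo U := R b * R a - R (a *h b).

Lemma bracket_associator_op a b :
  lieb (R b) (R a) - 2%:R *: associator_op a b =
  2%:R *: R (a *h b) - (R b * R a + R a * R b).
Proof.
rewrite liebE /associator_op !scaler_nat !mulr2n opprD !opprB addrA.
rewrite [X in X + _ = _]addrC subrKA addrACA -opprD.
by rewrite [R a * R b + _]addrC.
Qed.

(** Up to a factor 2, the operator is F - R_(F 1) for the coderivation
    F = [R_b, R_a], because R_a R_b + R_b R_a is a right multiplication. *)
Lemma coder_associator_op a b : Prim a -> Prim b -> coder (associator_op a b).
Proof.
move=> aP bP; set e := associator_op a b; set F := lieb (R b) (R a).
have FP : coder F by apply: coder_bracket; exact: coder_rmul.
have e1 : e 1h = 0 by rewrite /e endoDE endoNE endoME !rmul1 subrr.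
have FE := bracket_associator_op a b; rewrite -/e -/F in FE.
have [w _ wE] : rmuls (F - 2%:R *: e).
  rewrite FE; apply: subspaceB => //; last exact: rmuls_anticomm.
  by apply: subspaceZ => //; exists (a *h b).
have eE : 2%:R *: e = - R w + F by rewrite wE opprB subrK.
rewrite -[e](scalerK two0) eE -scaleN1r.
have wF : w = F 1h.
  by rewrite -(rmul1 w) wE endoDE endoNE endoZE e1 scaler0 oppr0 addr0.
rewrite -[_ *: _]addr0; apply: coderP; last exact: coder0.
by apply: coderP => //; apply: coder_rmul; rewrite wF; exact: coder_Prim.
Qed.

(** This is T R_y = R_y d + R_(T y) after substituting d = D - R_p / 2 and
    T = D + R_p / 2, where p = T(1). *)
Lemma bracket_average d T y (D := 2%:R^-1 *: (d + T)) :
  pseudoderivation d T ->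
  lieb D (R y) = R (T y) - 2%:R^-1 *: (R y * R (T 1h) + R (T 1h) * R y).
Proof.
move=> dT; set X := R (T 1h); set A := R y.
have E1 := pseudoderivation_rmul y dT; rewrite -/A in E1.
have TE := pseudoderivationE dT; rewrite -/X in TE.
have dE : d = T - X by rewrite {1}TE addrK.
rewrite liebE /D -endo_scaleAl -endo_scaleAr -scalerBr.
suff -> : (d + T) * A - A * (d + T) = 2%:R *: R (T y) - (A * X + X * A).
  by rewrite scalerBr scalerA mulVf // scale1r.
have dA : d * A = A * d + R (T y) - X * A by rewrite {1}dE mulrBl E1.
rewrite mulrDl mulrDr E1 {2}TE mulrDr dA scaler_nat mulr2n.
rewrite [A * d + R _]addrC opprD addrACA addrKA [_ - X * A - _]addrAC addrK.
rewrite addrACA -opprD.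
by rewrite [X * A + _]addrC.
Qed.

(** Here R_a R_p + R_p R_a is a right multiplication, both a and p = T(1) being
    primitive. *)
Lemma average_normalizes d T a : pseudoderivation d T -> Prim a ->
  rprim (lieb (2%:R^-1 *: (d + T)) (R a)).
Proof.
move=> dT aP; have [dP TP _] := dT.
apply: coder_rmuls.
  apply: coder_bracket; last exact: coder_rmul.
  by apply: (subspaceZ coder_sub); exact: (subspaceD coder_sub).
rewrite bracket_average //; apply: subspaceB => //; first by exists (T a).
by apply: subspaceZ => //; apply: rmuls_anticomm => //; exact: coder_Prim.
Qed.

(** Strong induction on n: once the (ad R_a)^(2j) X lie in c for j < n, all the
    terms of bernoulli_identity applied to X are right multiplications, except
    possibly the one with j = n, a nonzero multiple of (ad R_a)^(2n) X. *)
Lemma even_brackets a X n : Prim a -> rprim X ->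
    (forall n, rmuls (R a ^+ n * X + X * R a ^+ n)) ->
  rprim (iter n.*2 (lieb (R a)) X).
Proof.
move=> aP XP anti; set A := R a.
pose s := lact A + ract A; pose d := lact A - ract A.
(* d acts as the bracket with R_a *)
have dE m f : (d ^+ m) f = iter m (lieb A) f by rewrite endoXE.
have sd : GRing.comm s d.
  apply: commrB; apply: commr_sym; apply: commrD => //.
  - exact: comm_lract.
  - exact/commr_sym/comm_lract.
have iterP m : coder (iter m (lieb A) X).
  elim: m => [|m IHm]; first exact: rprim_coder.
  by apply: coder_bracket => //; exact: coder_rmul.
elim/ltn_ind: n => n IHn; apply: coder_rmuls; first exact: iterP.
have [g gP] := bernoulli_ex char0 n.
have := bernoulli_identity sd gP.
have -> : s + d = lact A *+ 2 by rewrite /s /d addrACA subrr addr0 mulr2n.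
have -> : s - d = ract A *+ 2.
  by rewrite /s /d opprB [lact A + _]addrC addrACA subrr addr0 mulr2n.
move/(congr1 (fun f : endo (endo U) => f X)); rewrite endo_sumE.
rewrite big_nat_recr //= subnn endoMnE endoDE !exprMn_n !endoMnE lactX ractX.
rewrite dE => E.
have c0 : 'C(n.*2.+1, n.*2)%:R * g n != 0.
  by rewrite binSn mulf_neq0 ?natf0 // (bernoulli_neq0 char0 gP).
apply: (subspaceZr rmuls_sub c0).
rewrite (geom2_1 (lact A *+ 2)) in E.
move: E => /(canRL (addKr _)); rewrite endo1E => ->.
rewrite addrC; apply: subspaceB => //.
  by rewrite -mulrnDl; do 2!apply: subspaceMn => //.
rewrite big_nat; apply: subspace_sum => // j /andP[_ jn].
rewrite dE; apply: subspaceZ => //.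
have [b bP <-] := IHn j jn.
have -> : geom2 (lact A *+ 2) (ract A *+ 2) (n - j).*2.+1 =
    geom2 (lact A) (ract A) (n - j).*2.+1 *+ 2 ^ (n - j).*2.
  rewrite /geom2 -sumrMnl; apply: eq_bigr => i _ /=.
  rewrite !exprMn_n mulrnAl mulrnAr -mulrnA -expnD; congr (_ *+ 2 ^ _).
  by have := ltn_ord i; lia.
by rewrite endoMnE; apply: subspaceMn => //; exact: sandwichP.
Qed.

(** In bracket_average at y = a^n, the bracket [D, R_a^n] is a right
    multiplication since [D, R_a] is some R_b with b primitive. *)
Lemma even_brackets_companion d T a n : pseudoderivation d T -> Prim a ->
  (forall n, R (rpow a n) = R a ^+ n) ->
  rprim (iter n.*2 (lieb (R a)) (R (T 1h))).
Proof.
move=> dT aP powE; have [dP TP _] := dT; have pP := coder_Prim TP.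
apply: even_brackets => // [|m]; first by exists (T 1h).
have := bracket_average (rpow a m) dT; rewrite powE bracket_exp.
move=> E; apply: (subspaceZr rmuls_sub (invr_neq0 two0)).
have -> : 2%:R^-1 *: (R a ^+ m * R (T 1h) + R (T 1h) * R a ^+ m) =
    R (T (rpow a m)) - sandwich (R a) m (lieb (2%:R^-1 *: (d + T)) (R a)).
  by rewrite E opprB [RHS]addrC subrK.
apply: subspaceB => //; first by exists (T (rpow a m)).
by have [b bP <-] := average_normalizes dT aP; exact: sandwichP.
Qed.

Definition pseudoderivable : set (endo U) :=
  [set f | exists d T, pseudoderivation d T /\ rprim (f - d)].
Local Notation G := pseudoderivable.

Let rprim_sub := @subspace_rprim k U.

Lemma subspace_pseudoderivable : subspace G.
Proof.
split.
  exists 0, 0; split; first exact: pseudoderivation0.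
  by rewrite subr0; exact: subspace0.
move=> c f f' [d [T [dT rf]]] [d' [T' [dT' rf']]].
exists (c *: d + d'), (c *: T + T'); split; first exact: pseudoderivationP.
by rewrite opprD addrACA -scalerBr; exact: rprim_sub.2.
Qed.

Let G_sub := subspace_pseudoderivable.

Lemma rprim_pseudoderivable f : rprim f -> G f.
Proof.
move=> fP; exists 0, 0; split; first exact: pseudoderivation0.
by rewrite subr0.
Qed.

Lemma pseudoderivation_derivable d T : pseudoderivation d T -> G d.
Proof.
by move=> dT; exists d, T; split=> //; rewrite subrr; exact: subspace0.
Qed.

Hypothesis assocP : forall a b : U, Prim a -> Prim b ->
  exists T, pseudoderivation (associator_op a b) T.

(** The bracket [R_b, R_a] differs from twice the pseudoderivation
    R_b R_a - R_(ab) by a right multiplication. *)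
Lemma pseudoderivable_rprim_bracket f g : rprim f -> rprim g -> G (lieb f g).
Proof.
case=> b bP <- [a aP <-]; set e := associator_op a b.
have [T eT] := assocP aP bP; rewrite -/e in eT; have [eP _ _] := eT.
rewrite -[lieb _ _](subrK (2%:R *: e)); apply: (subspaceD G_sub).
  apply/rprim_pseudoderivable/coder_rmuls.
    rewrite -scaleNr addrC; apply: coderP => //.
    by apply: coder_bracket; exact: coder_rmul.
  rewrite bracket_associator_op.
  apply: subspaceB => //; last exact: rmuls_anticomm.
  by apply: subspaceZ => //; exists (a *h b).
exact/(subspaceZ G_sub)/(pseudoderivation_derivable eT).
Qed.

(** With D = (d + T) / 2 one has d = D - R_p / 2, and D normalises c. *)
Lemma pseudoderivable_mixed_bracket d T f :
  pseudoderivation d T -> rprim f -> G (lieb d f).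
Proof.
move=> dT fP; have [a aP fE] := fP.
set D := 2%:R^-1 *: (d + T).
have -> : d = D - 2%:R^-1 *: R (T 1h).
  rewrite /D {1}(pseudoderivationE dT) addrA scalerDr addrK -mulr2n.
  by rewrite -scaler_nat scalerA mulVf // scale1r.
rewrite linearBl; apply: (subspaceB G_sub).
  by apply: rprim_pseudoderivable; rewrite -fE; exact: average_normalizes.
rewrite linearZl_LR; apply: (subspaceZ G_sub).
apply: pseudoderivable_rprim_bracket => //; exists (T 1h) => //.
by case: dT => _ /coder_Prim.
Qed.

Lemma lie_subalgebra_pseudoderivable : lie_subalgebra G.
Proof.
split=> [|f g [d [T [dT rf]]] [d' [T' [dT' rg]]]]; first exact: G_sub.
rewrite -[f](subrK d) -[g](subrK d').
move: (f - d) (g - d') rf rg => r r' rP r'P.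
have Grd : G (lieb r d').
  have -> : lieb r d' = (-1) *: lieb d' r by rewrite !liebE scaleN1r opprB.
  exact/(subspaceZ G_sub)/(pseudoderivable_mixed_bracket dT').
rewrite linearDl !linearDr.
apply: (subspaceD G_sub (subspaceD G_sub _ Grd)).
  exact: pseudoderivable_rprim_bracket.
apply: (subspaceD G_sub (pseudoderivable_mixed_bracket dT r'P)).
exact: pseudoderivation_derivable (pseudoderivation_bracket dT dT').
Qed.

(** An element d0 + R_a of the Lie algebra that kills 1 has a = 0. *)
Lemma inner_pseudoderivation d :
  lie_generated (@rprim k U) d -> d 1h = 0 -> exists T, pseudoderivation d T.
Proof.
move=> dG d1.
have [|d0 [T [dT [a _ aE]]]] := dG G lie_subalgebra_pseudoderivable.
  by move=> f; exact: rprim_pseudoderivable.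
exists T; have [_ _ dE] := dT.
have d01 : d0 1h = 0.
  have := dE 1h 1h; rewrite !hmul1l hmul1r => /(congr1 (+%R^~ (- T 1h))).
  by rewrite subrr addrK.
have a0 : a = 0 by rewrite -(rmul1 a) aE endoDE endoNE d1 d01 subrr.
suff -> : d = d0 by [].
apply/subr0_eq; rewrite -aE a0; apply/endoP => x.
by rewrite rmulE linear0r.
Qed.

End InnerStructure.

(** * The inner triple *)

Section Generated.
Variables (k : fieldType) (L : lieAlgType k).
Implicit Types A B : set L.

Lemma lie_subalgebra_generated A : lie_subalgebra (lie_generated A).
Proof.
split; first split.
- by move=> B [[B0 _] _] _.
- move=> c x y xA yA B Bsub AB.
  by apply: Bsub.1.2; [exact: xA|exact: yA].
- by move=> x y xA yA B Bsub AB; apply: Bsub.2; [exact: xA|exact: yA].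
Qed.

Lemma sub_generated A : A `<=` lie_generated A.
Proof. by move=> x Ax B _; apply. Qed.

Lemma lie_subalgebraI A B :
  lie_subalgebra A -> lie_subalgebra B -> lie_subalgebra (A `&` B).
Proof.
move=> [[A0 AP] AL] [[B0 BP] BL]; split; first split.
- by [].
- by move=> c x y [Ax Bx] [Ay By]; split; [exact: AP|exact: BP].
- by move=> x y [Ax Bx] [Ay By]; split; [exact: AL|exact: BL].
Qed.

End Generated.

Section InnerTriple.
Variables (k : fieldType) (U : bialgType k).

Lemma lie_subalgebra_coder1 : lie_subalgebra (@coder1 k U).
Proof.
split; first split.
- by split; first exact: coder0.
- move=> c x y [xP x1] [yP y1]; split; first exact: coderP.
  by rewrite endoDE endoZE x1 y1 scaler0 addr0.
- move=> x y [xP x1] [yP y1]; split; first exact: coder_bracket.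
  by rewrite liebfE x1 y1 (linear0 x) (linear0 y) subrr.
Qed.

Lemma inner_is_triple : is_triple (inner (triple_of U)).
Proof.
have gP := lie_subalgebra_generated (@rprim k U).
split=> /=.
- exact: gP.
- exact: (lie_subalgebraI gP lie_subalgebra_coder1).
- exact: subspace_rprim.
- apply/seteqP; split=> [f fg|_ [d [dg _] [c cP <-]]]; last first.
    by apply: (subspaceD gP.1 dg); exact: sub_generated.
  have fP : coder f.
    by apply: fg; [exact: lie_subalgebra_coder|exact: rprim_coder].
  have rP : rprim (rmul (f 1h)) by exists (f 1h) => //; exact: coder_Prim.
  exists (f - rmul (f 1h)); last by exists (rmul (f 1h)); rewrite ?subrK.
  split; first by apply: (subspaceB gP.1 fg); exact: sub_generated.
  split; last by rewrite endoDE endoNE rmul1 subrr.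
  by apply: (subspaceB (lie_subalgebra_coder U).1 fP); exact: rprim_coder.
- apply/seteqP; split=> [f [[_ [_ f1]] [a _ fE]]|_ ->].
    move: f1; rewrite -fE rmul1 => ->; apply/endoP => x.
    by rewrite rmulE linear0r.
  split; last exact: (subspace_rprim U).1.
  exact: (lie_subalgebraI gP lie_subalgebra_coder1).1.1.
Qed.

End InnerTriple.

Theorem proposition5p6 (k : fieldType) (char0 : [pchar k]%R =i pred0)
  (U : hopfType k) (hU : pseudoreductive_hopf U) :
  pseudoreductive_triple (inner (triple_of U)).
Proof.
case: hU => -[m [m_morph m1l m1r m_pseudo]] /right_monoalternative2 mono.
have sandwichP := sandwich_rmuls char0 mono.
have assocP (a b : U) : Prim a -> Prim b ->
    exists T, pseudoderivation (associator_op a b) T.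
  move=> aP bP; exists (associator_op a b + rmul (m (a \ox b))).
  have eE x : associator_op a b x = rmap a b x by rewrite rmap_Prim.
  have TE x : (associator_op a b + rmul (m (a \ox b))) x = Pmap m a b x.
    by rewrite Pmap_Prim // endoDE eE.
  have eP := coder_associator_op char0 sandwichP aP bP.
  split=> //.
    apply: (subspaceD (lie_subalgebra_coder U).1 eP).
    by apply: coder_rmul; exact: Prim_morphism.
  by move=> x y; rewrite !TE eE; exact: rmap_pseudoderivation.
split; first exact: inner_is_triple.
have companion d : exists T, (lie_generated (@rprim k U) `&` @coder1 k U) d ->
    pseudoderivation d T.
  have [dP|] := pselect ((lie_generated (@rprim k U) `&` @coder1 k U) d).
    have [|T dT] := inner_pseudoderivation char0 sandwichP assocP dP.1.
      exact: dP.2.2.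
    by exists T.
  by exists 0.
have {companion} [T TP] := choice companion.
have gP := lie_subalgebra_generated (@rprim k U).
have zetaP d : (lie_generated (@rprim k U) `&` @coder1 k U) d ->
    rprim (2%:R^-1 *: rmul (T d 1h)).
  move=> /TP dT; apply: (subspaceZ (subspace_rprim U)).
  by exists (T d 1h) => //; case: dT => _ /coder_Prim.
exists (fun d => 2%:R^-1 *: rmul (T d 1h)); split=> /=.
- exact: zetaP.
- move=> d dP; have dT := TP d dP.
  split.
    by apply: (subspaceD gP.1 dP.1); apply: sub_generated; exact: zetaP.
  move=> _ [a aP <-].
  have -> : d + 2%:R^-1 *: rmul (T d 1h) = 2%:R^-1 *: (d + T d).
    rewrite [in RHS](pseudoderivationE dT) addrA scalerDr -mulr2n -scaler_nat.
    by rewrite scalerA mulVf ?natf0 // scale1r.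
  exact: average_normalizes.
- move=> n _ d [a aP <-] dP.
  have -> : iter (2 * n) (lieb (rmul a)) (2%:R^-1 *: rmul (T d 1h)) =
      2%:R^-1 *: iter n.*2 (lieb (rmul a)) (rmul (T d 1h)).
    rewrite mul2n; elim: n.*2 => // j IHj.
    by rewrite !iterS IHj linearZr_LR.
  apply: (subspaceZ (subspace_rprim U)).
  apply: (even_brackets_companion char0 sandwichP _ (TP d dP) aP) => j.
  exact: rmul_rpow.
Qed.
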